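(* Let $\lambda > 0$ and let $D \subset \mathbb{R}^3$ be a bounded domain (connected open set) whose complement $\mathbb{R}^3 \setminus D$ is connected. Let $r > 0$ be such that $|B_r| = |D|$, where $|\cdot|$ denotes Lebesgue measure (volume) and $B_r$ is an open ball of radius $r$. Define the complex-valued functions $$E_\lambda^{\pm}(x,y) = \frac{\exp\{\pm \mathrm{i}\lambda|x-y|\}}{|x-y|}, \qquad x \neq y,$$ and $$a_3^-(t) = \Gamma\!\left(\tfrac{5}{2}\right)\frac{J_{3/2}(t)}{(t/2)^{3/2}},$$ where $J_{3/2}$ is the Bessel function of order $3/2$. Suppose that for some $x_0 \in D$ we have $D \subset B_{r_0}(x_0)$, where $r_0 > 0$ is defined by $\lambda r_0 = j_{3/2,1}$, the first positive zero of $J_{3/2}$, and that the identities $$a_3^-(\lambda r)\, E_\lambda^{+}(x, x_0) = \frac{1}{|D|}\int_D E_\lambda^{+}(y, x)\, \mathrm{d}y \quad\text{and}\quad a_3^-(\lambda r)\, E_\lambda^{-}(x, x_0) = \frac{1}{|D|}\int_D E_\lambda^{-}(y, x)\, \mathrm{d}y$$ both hold for every $x \in \mathbb{R}^3 \setminus D$. Then $D = B_r(x_0)$, the open ball of radius $r$ centred at $x_0$.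
   Context: $E_\lambda^{\pm}$ are the two fundamental solutions of the Helmholtz equation $\nabla^2 u + \lambda^2 u = 0$ in $\mathbb{R}^3$. $B_\rho(x) = \{y \in \mathbb{R}^3 : |y-x| < \rho\}$. *)

(* Defs.v *)
From HB Require Import structures.
From mathcomp Require Import all_boot all_order all_algebra.
From mathcomp Require Import all_classical all_reals all_analysis.
From mathcomp Require Import complex.
Set Implicit Arguments. Unset Strict Implicit. Unset Printing Implicit Defensive.
Import Order.TTheory GRing.Theory Num.Theory.
Import numFieldNormedType.Exports.
Local Open Scope classical_set_scope.
Local Open Scope ring_scope.
Local Open Scope complex_scope.

Section Defs.
Variable R : realType.

Definition R3 := ((R * R) * R)%type.

Definition dist3 (x y : R3) : R :=
  Num.sqrt ((x.1.1 - y.1.1) ^+ 2 + (x.1.2 - y.1.2) ^+ 2 + (x.2 - y.2) ^+ 2).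

Definition ball3 (x : R3) (rho : R) : set R3 := [set y | dist3 y x < rho].

Definition leb3 : set R3 -> \bar R :=
  ((@lebesgue_measure R \x @lebesgue_measure R) \x @lebesgue_measure R)%E.

Definition bounded3 (D : set R3) : Prop :=
  exists M : R, forall x, D x -> dist3 x ((0, 0), 0) <= M.

Definition Gamma (s : R) : R :=
  Rintegral (@lebesgue_measure R) `[0, +oo[%classic
    (fun t => powR t (s - 1) * expR (- t)).

(* Bessel function of the first kind of order nu, for t > 0:
   J_nu(t) = sum_k (-1)^k / (k! Gamma(k + nu + 1)) (t/2)^(2k+nu). *)
Definition besselJ (nu t : R) : R :=
  limn (series (fun k : nat =>
    (-1) ^+ k / (k`!%:R * Gamma (k%:R + nu + 1)) * powR (t / 2) (2 * k%:R + nu))).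

Definition a3m (t : R) : R :=
  Gamma (5 / 2) * besselJ (3 / 2) t / powR (t / 2) (3 / 2).

Definition first_pos_zero_J32 (j : R) : Prop :=
  0 < j /\ besselJ (3 / 2) j = 0 /\ (forall t, 0 < t < j -> besselJ (3 / 2) t != 0).

(* The fundamental solutions E_lambda^{+-}(x,y) = exp(+- i lambda |x-y|)/|x-y|,
   with exp(i theta) = cos theta + i sin theta. *)
Definition Eplus (lam : R) (x y : R3) : R[i] :=
  let d := dist3 x y in (cos (lam * d) / d) +i* (sin (lam * d) / d).
Definition Eminus (lam : R) (x y : R3) : R[i] :=
  let d := dist3 x y in (cos (lam * d) / d) +i* (- (sin (lam * d) / d)).

Definition cintegral3 (D : set R3) (f : R3 -> R[i]) : R[i] :=
  (Rintegral leb3 D (fun y => complex.Re (f y))) +i* (Rintegral leb3 D (fun y => complex.Im (f y))).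

End Defs.

(* Main.v *)
Require Import Defs.
From HB Require Import structures.
From mathcomp Require Import all_boot all_order all_algebra.
From mathcomp Require Import all_classical all_reals all_analysis.
From mathcomp Require Import measurable_realfun complex ring lra.
Import Order.TTheory GRing.Theory Num.Theory.
Import numFieldNormedType.Exports.
Local Open Scope classical_set_scope.
Local Open Scope ring_scope.

(** Write [k(d) = sin(lam d)/d], [t = lam r] and [c = |D| a(t)], where
    [a(t) = 3 (sin t - t cos t)/t^3].  Only the identity for [E^+] is used.

    In the coordinates [z = (y - o).e] and [q = |y - o|^2 - z^2] attached to a
    point [o] and a unit vector [e], Lebesgue measure becomes a multiple of
    [dz dq] on [q >= 0]; invariance under translations along [e] and under
    homotheties suffices to see this.  Hence [int_{B_s(x0)} g(|y - x|)/|y - x| dy]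
    is elementary for [|x - x0| < s].  For [g(d) = sin(lam d)] it equals
    [M(s) k(|x - x0|)] with [M(s) = |B_s| a(lam s)].

    Integrating the imaginary part of the identity over a spherical shell
    around [D], with radii for which [M] takes different values, and exchanging
    the integrals gives [int_D k(|y - x0|) dy = c lam = int_{B_r(x0)} k(|y - x0|) dy].
    Since [k] is strictly decreasing on [0, r0] and [|D| = |B_r|], the sets
    [D] and [B_r(x0)] differ by a null set; as [D] is open, [D] lies in
    [B_r(x0)].  At a point [x] of [B_r(x0) \ D] the real part of the identity
    would hold with [B_r(x0)] in place of [D], but there the two sides differ by
    a positive multiple of [t (cos s - 1) + s - sin s < 0], [s = lam (r - |x - x0|)]. *)

(** * Lebesgue measure on the space *)

Section Measure.
Context (R : realType).
Local Notation mR := (measurableTypeR R).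
Local Notation T3 := (mR * mR * mR)%type.
Local Notation mu := (@lebesgue_measure R).

(** The identities are known only off [D], while the formula [M(s) k] holds only at points inside
    the ball. A shell is the difference of two balls that both contain [D]: its points lie off [D],
    and each point of [D] lies inside both balls.

    Coordinates are centred at the singularity [x], not at the centre of the ball, so that the
    kernel depends on [z^2 + q] alone. The change of variables is justified for nonnegative
    integrands; an oscillating kernel [g(d)/d] with [g >= -1] is reached as the difference of
    [(1 + g(d))/d] and [1/d].

    The radius [r0] enters because [k] has derivative [-(sin u - u cos u)/d^2] at [u = lam d], and
    [sin u - u cos u] is [J_{3/2}(u)] up to a positive factor. The same positivity,
    [sin s > s cos s], gives the sign of the final defect.

    The last step has to use the real part: [k] is regular at the origin, so for a ball the
    imaginary identity holds at inner points as well and cannot detect a missing point. The cosine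
    kernel is singular and does detect it. *)

Lemma sigma_finite_product d1 d2 (T1 : measurableType d1) (T2 : measurableType d2)
    (m1 : {sigma_finite_measure set T1 -> \bar R})
    (m2 : {sigma_finite_measure set T2 -> \bar R}) :
  sigma_finite [set: (T1 * T2)%type] (m1 \x m2)%E.
Proof.
have [F FT Ffin] := sigma_finiteT m1; have [G GT Gfin] := sigma_finiteT m2.
(* Numbers that code no pair fall back on the pair of zeros; the repetition is harmless, since the
   cover need not be disjoint. *)
exists (fun n => let i := odflt (0%N, 0%N) (unpickle n) in F i.1 `*` G i.2).
  apply/seteqP; split=> // -[x y] _.
  have [i _ Fi] : (\bigcup_i F i) x by rewrite -FT.
  have [j _ Gj] : (\bigcup_i G i) y by rewrite -GT.
  by exists (pickle (i, j)) => //; rewrite pickleK.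
move=> n; case: (odflt _ _) => i j /=.
have [mF Fy] := Ffin i; have [mG Gy] := Gfin j.
split; first exact: measurableX.
by rewrite product_measure1E// lte_mul_pinfty// ge0_fin_numE.
Qed.

(* [leb2] and [lebT3] name iterated products so that their sigma-finiteness is
   inferred; [lebT3] is convertible to [leb3]. *)
Definition leb2 : set (mR * mR)%type -> \bar R := (mu \x mu)%E.
HB.instance Definition _ := Measure.on leb2.
HB.instance Definition _ := Measure_isSigmaFinite.Build _ _ _ leb2
  (sigma_finite_product _ _ _ _ mu mu).

Definition lebT3 : set T3 -> \bar R := (leb2 \x mu)%E.
HB.instance Definition _ := Measure.on lebT3.
HB.instance Definition _ := Measure_isSigmaFinite.Build _ _ _ lebT3
  (sigma_finite_product _ _ _ _ leb2 mu).

Lemma leb3E : @leb3 R = lebT3. Proof. by []. Qed.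


(** The proof [mf] is an explicit argument, so that the pushforward can be used wherever a bundled
    measure is expected. *)
Definition image_measure d1 d2 (T1 : measurableType d1) (T2 : measurableType d2)
    (m : {measure set T1 -> \bar R}) (f : T1 -> T2)
    (mf : measurable_fun setT f) : {measure set T2 -> \bar R}.
Proof. by refine (pushforward m f : {measure set T2 -> \bar R}). Defined.

Lemma scale_cancel (c1 c2 : R) (x y : \bar R) : 0 < c1 -> 0 < c2 ->
  ((c1 * c2)^-1%:E * ((c1%:E * x) * (c2%:E * y)) = x * y)%E.
Proof.
move=> c10 c20; transitivity (((c1 * c2)^-1 * (c1 * c2))%:E * (x * y))%E.
  by rewrite 2!EFinM -[RHS]muleA; congr (_ * _)%E; rewrite [LHS]muleACA.
by rewrite mulVf ?mul1e// mulf_neq0 ?gt_eqF.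
Qed.

(** Divided by [c1 * c2], the image measure agrees with the product measure on rectangles, hence
    everywhere by uniqueness. *)
Lemma pushforward_product d1 d2 (T1 : measurableType d1) (T2 : measurableType d2)
    (m1 : {sigma_finite_measure set T1 -> \bar R})
    (m2 : {sigma_finite_measure set T2 -> \bar R})
    (f1 : T1 -> T1) (f2 : T2 -> T2) (c1 c2 : R) :
  measurable_fun setT f1 -> measurable_fun setT f2 -> 0 < c1 -> 0 < c2 ->
  (forall A, measurable A -> m1 (f1 @^-1` A) = (c1%:E * m1 A)%E) ->
  (forall A, measurable A -> m2 (f2 @^-1` A) = (c2%:E * m2 A)%E) ->
  forall X, measurable X ->
    (m1 \x m2)%E ((fun x => (f1 x.1, f2 x.2)) @^-1` X) =
    ((c1 * c2)%:E * (m1 \x m2)%E X)%E.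
Proof.
move=> mf1 mf2 c10 c20 E1 E2 X mX.
pose f (x : T1 * T2) := (f1 x.1, f2 x.2).
have mf : measurable_fun setT f.
  by apply: measurable_fun_pair; apply: measurableT_comp.
have c0 : 0 <= (c1 * c2)^-1 by rewrite invr_ge0 mulr_ge0 ?ltW.
pose m' := mscale (NngNum c0) (image_measure _ _ _ _ (m1 \x m2)%E _ mf).
have m'E A : m' A = ((c1 * c2)^-1%:E * (m1 \x m2)%E (f @^-1` A))%E by [].
have H : forall A B, measurable A -> measurable B ->
    m' (A `*` B) = (m1 A * m2 B)%E; last first.
  have -> : (m1 \x m2)%E X = m' X by exact: product_measure_unique.
  rewrite m'E muleA -EFinM mulfV ?mul1e//.
  by rewrite mulf_neq0 ?gt_eqF.
move=> A B mA mB; rewrite m'E.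
have -> : (f @^-1` (A `*` B)) = (f1 @^-1` A) `*` (f2 @^-1` B) by [].
have mA' : measurable (f1 @^-1` A) by rewrite -[X in measurable X]setTI; exact: mf1.
have mB' : measurable (f2 @^-1` B) by rewrite -[X in measurable X]setTI; exact: mf2.
transitivity ((c1 * c2)^-1%:E * ((c1%:E * m1 A) * (c2%:E * m2 B)))%E.
  congr (_ * _)%E; transitivity (m1 (f1 @^-1` A) * m2 (f2 @^-1` B))%E.
    exact: product_measure1E.
  by congr (_ * _)%E; [exact: E1|exact: E2].
exact: scale_cancel.
Qed.

(** The preimage of []a, b]] is [](a - v)/s, (b - v)/s]], so [s] times the image measure agrees with
    Lebesgue measure on half-open intervals, which determine it. *)
Lemma lebesgue_measure_affine (v s : R) : 0 < s -> forall A : set mR, measurable A ->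
  mu ((fun x : mR => v + s * x : mR) @^-1` A) = (s^-1%:E * mu A)%E.
Proof.
move=> s0 A mA; pose f (x : mR) : mR := v + s * x.
have mf : measurable_fun setT f.
  by apply: measurable_funD => //; apply: measurable_funM.
pose m' := mscale (NngNum (ltW s0)) (image_measure _ _ _ _ mu _ mf).
have m'E B : m' B = (s%:E * mu (f @^-1` B))%E by [].
have H : forall B, ocitv B -> mu B = m' B; last first.
  have -> : mu A = m' A by exact: lebesgue_measure_unique.
  by rewrite m'E muleA -EFinM mulVf ?mul1e// gt_eqF.
move=> _ [[a b]] _ <-; rewrite m'E.
have -> : f @^-1` [set` `]a, b]] = [set` `](a - v) / s, (b - v) / s]].
  apply/seteqP; split=> x /=; rewrite !in_itv/= /f;
  by rewrite ltr_pdivrMr// ler_pdivlMr// (mulrC x) ltrBlDl lerBrDl.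
rewrite !lebesgue_measure_itv/= !lte_fin ltr_pM2r ?invr_gt0// ltrD2r.
case: ifP => _; rewrite ?mule0// -!EFinD -EFinM; congr (_%:E).
by field; rewrite gt_eqF.
Qed.

(** Serves for translations ([s = 1]) and, with a suitable [v], for homotheties about any point. *)
Lemma leb3_affine (v : R3 R) (s : R) : 0 < s -> forall A : set T3, measurable A ->
  @leb3 R ((fun x => (v.1.1 + s * x.1.1, v.1.2 + s * x.1.2, v.2 + s * x.2)) @^-1` A) =
  ((s ^- 3)%:E * @leb3 R A)%E.
Proof.
move=> s0 A mA; have si : 0 < s^-1 by rewrite invr_gt0.
have maf (w : R) : measurable_fun setT (fun x : mR => w + s * x : mR).
  by apply: measurable_funD => //; apply: measurable_funM.
rewrite leb3E /lebT3; pose g (w : R) (x : mR) : mR := w + s * x.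
have := @pushforward_product _ _ _ _ leb2 mu
  (fun x => (g v.1.1 x.1, g v.1.2 x.2)) (g v.2) (s^-1 * s^-1) s^-1.
move=> /(_ _ _ _ _ _ _ A mA) ->//.
- by congr (_%:E * _)%E; rewrite !exprS expr0 mulr1 !invfM mulrA.
- by apply: measurable_fun_pair; apply: measurableT_comp => //; exact: maf.
- exact: maf.
- exact: mulr_gt0.
- by move=> B mB; apply: pushforward_product => //; try exact: maf;
    move=> C mC; exact: lebesgue_measure_affine.
- by move=> B mB; exact: lebesgue_measure_affine.
Qed.

End Measure.

(** * Polar decomposition of Lebesgue measure *)

(** With [N] the integer part of [n x], additivity and monotonicity place [n f(x)] between [N f(1)]
    and [(N + 1) f(1)]. Hence [n |f(x) - x f(1)| <= f(1)] for every [n], and the archimedean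
    property concludes. *)
Lemma monotone_additive_linear (R : realType) (f : R -> R) :
  (forall x, 0 <= x -> 0 <= f x) ->
  (forall x y, 0 <= x -> 0 <= y -> f (x + y) = f x + f y) ->
  forall x, 0 <= x -> f x = x * f 1.
Proof.
move=> f0 fD x x0.
have f1 : 0 <= f 1 by exact: f0.
have f00 : f 0 = 0 by have := fD 0 0 (lexx _) (lexx _); rewrite addr0; lra.
have fM n y : 0 <= y -> f (n%:R * y) = n%:R * f y.
  move=> y0; elim: n => [|n IH]; first by rewrite !mul0r.
  by rewrite -natr1 mulrDl mul1r fD ?mulr_ge0// IH mulrDl mul1r.
have fle y z : 0 <= y -> y <= z -> f y <= f z.
  move=> y0 yz; rewrite -(subrK y z) addrC fD ?subr_ge0//.
  by rewrite lerDl f0 ?subr_ge0.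
have bnd n : n%:R * `|f x - x * f 1| <= f 1.
  have nx0 : 0 <= n%:R * x by rewrite mulr_ge0.
  have /andP[m1 m2] := truncn_itv nx0.
  have m0 : 0 <= (Num.trunc (n%:R * x))%:R :> R by [].
  have := fle _ _ m0 m1; have := fle _ _ nx0 (ltW m2).
  rewrite !fM// -[X in f X <= _]mulr1 -[X in _ <= f X]mulr1 !fM//.
  rewrite -natr1 in m2 * => h1 h2.
  rewrite -[n%:R]ger0_norm// -normrM ler_norml; apply/andP; split; nra.
apply/eqP; rewrite -subr_eq0 -normr_eq0; apply/negPn/negP => ne.
have pos : 0 < `|f x - x * f 1| by rewrite lt_neqAle eq_sym ne/=.
have := bnd (Num.trunc (f 1 / `|f x - x * f 1|)).+1.
rewrite -ler_pdivlMr// leNgt => /negP; apply.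
by have /andP[] := truncn_itv (divr_ge0 f1 (ltW pos)).
Qed.

Section Polar.
Context (R : realType).
Local Notation mR := (measurableTypeR R).
Local Notation T3 := (mR * mR * mR)%type.
Local Notation mu := (@lebesgue_measure R).

Lemma measurable_coord :
  [/\ measurable_fun setT (fun y : T3 => y.1.1 : R),
      measurable_fun setT (fun y : T3 => y.1.2 : R) &
      measurable_fun setT (fun y : T3 => y.2 : R)].
Proof.
split.
- exact: (measurableT_comp (measurable_fst (T1 := mR) (T2 := mR)) measurable_fst).
- exact: (measurableT_comp (measurable_snd (T1 := mR) (T2 := mR)) measurable_fst).
- exact: measurable_snd.
Qed.

Definition axial (o e y : R3 R) : R :=
  (y.1.1 - o.1.1) * e.1.1 + (y.1.2 - o.1.2) * e.1.2 + (y.2 - o.2) * e.2.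

Definition sqdist (o y : R3 R) : R :=
  (y.1.1 - o.1.1) ^+ 2 + (y.1.2 - o.1.2) ^+ 2 + (y.2 - o.2) ^+ 2.

(** For a unit vector [e], the squared distance to the axis. The square makes the density constant:
    the area of a disc is proportional to its squared radius. *)
Definition transverse (o e y : R3 R) : R := sqdist o y - axial o e y ^+ 2.

Lemma measurable_axial o e : measurable_fun setT (axial o e : T3 -> R).
Proof.
have [m1 m2 m3] := measurable_coord.
by do 2?[apply: measurable_funD]; apply: measurable_funM => //; apply: measurable_funB.
Qed.

Lemma measurable_sqdist o : measurable_fun setT (sqdist o : T3 -> R).
Proof.
have [m1 m2 m3] := measurable_coord.
by do 2?[apply: measurable_funD]; apply: measurable_funX => //; apply: measurable_funB.
Qed.

Lemma measurable_transverse o e : measurable_fun setT (transverse o e : T3 -> R).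
Proof.
apply: measurable_funB; first exact: measurable_sqdist.
by apply: measurable_funX; exact: measurable_axial.
Qed.

Definition polar o e (y : T3) : mR * mR := (axial o e y, transverse o e y).

Lemma measurable_polar o e : measurable_fun setT (polar o e).
Proof.
by apply: measurable_fun_pair; [exact: measurable_axial|exact: measurable_transverse].
Qed.

Lemma leb3_box (a1 b1 a2 b2 a3 b3 : R) :
  @leb3 R ([set` `[a1, b1]] `*` [set` `[a2, b2]] `*` [set` `[a3, b3]]) =
  (mu `[a1, b1] * mu `[a2, b2] * mu `[a3, b3])%E.
Proof.
rewrite leb3E.
transitivity (leb2 R ([set` `[a1, b1]] `*` [set` `[a2, b2]]) * mu `[a3, b3])%E.
  by apply: product_measure1E => //; apply: measurableX.
by congr (_ * _)%E; exact: product_measure1E.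
Qed.

Lemma leb3_bounded (o : R3 R) (M : R) (A : set T3) : measurable A ->
  (forall y, A y -> sqdist o y <= M) -> (@leb3 R A < +oo)%E.
Proof.
move=> mA AM.
(* From [a^2 <= M] follows [|a| <= a^2 + 1 <= M + 1], which avoids a square root. *)
pose N := M + 1.
have sub : A `<=` [set` `[o.1.1 - N, o.1.1 + N]] `*` [set` `[o.1.2 - N, o.1.2 + N]]
                  `*` [set` `[o.2 - N, o.2 + N]].
  move=> y /AM; rewrite /sqdist/N /= => h.
  have s0 := sqr_ge0 (y.1.1 - o.1.1); have s1 := sqr_ge0 (y.1.2 - o.1.2).
  have s2 := sqr_ge0 (y.2 - o.2).
  rewrite /= !in_itv/=; repeat split; apply/andP; split; nra.
apply: (@le_lt_trans _ _ (@leb3 R ([set` `[o.1.1 - N, o.1.1 + N]] `*`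
    [set` `[o.1.2 - N, o.1.2 + N]] `*` [set` `[o.2 - N, o.2 + N]]))).
  rewrite leb3E; apply: le_measure; rewrite ?inE//.
  by apply: measurableX => //; apply: measurableX.
rewrite leb3_box !lebesgue_measure_itv/=.
by do 3![case: ifP => _]; rewrite ?mul0e ?mule0// -!EFinD -!EFinM ltry.
Qed.

End Polar.

(** * Volumes of circular cylinders from translations and homotheties *)

Section Cylinder.
Context (R : realType).
Local Notation mR := (measurableTypeR R).
Local Notation T3 := (mR * mR * mR)%type.
Local Notation mu := (@lebesgue_measure R).
Variables (o e : R3 R).
Hypothesis e1 : e.1.1 ^+ 2 + e.1.2 ^+ 2 + e.2 ^+ 2 = 1.

(* [q] bounds the squared distance to the axis. *)
Definition cyl (a b q : R) : set T3 :=
  [set y | [/\ a < axial R o e y, axial R o e y <= b & transverse R o e y <= q]].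

(** Lagrange's identity: with [|e| = 1], the difference [|v|^2 - (v.e)^2] is the squared norm of the
    cross product of [v] and [e]. *)
Lemma transverse_ge0 y : 0 <= transverse R o e y.
Proof.
rewrite /transverse /sqdist /axial.
move: (y.1.1 - o.1.1) (y.1.2 - o.1.2) (y.2 - o.2) => a b c.
have -> : a ^+ 2 + b ^+ 2 + c ^+ 2 - (a * e.1.1 + b * e.1.2 + c * e.2) ^+ 2 =
    (a * e.1.2 - b * e.1.1) ^+ 2 + (a * e.2 - c * e.1.1) ^+ 2
    + (b * e.2 - c * e.1.2) ^+ 2.
  rewrite -[X in X - _]mulr1 -e1; ring.
by rewrite !addr_ge0 ?sqr_ge0.
Qed.

Lemma measurable_cyl a b q : measurable (cyl a b q).
Proof.
have mz := measurable_axial R o e; have mq := measurable_transverse R o e.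
have -> : cyl a b q = (axial R o e @^-1` [set` `]a, b]]) `&`
    (transverse R o e @^-1` [set` `]-oo, q]]).
  apply/seteqP; split=> y /=; rewrite !in_itv/=.
    by case=> -> -> ->.
  by case=> /andP[].
by apply: measurableI; rewrite -[X in measurable X]setTI; [exact: mz|exact: mq].
Qed.

Lemma cyl_fin a b q : (@leb3 R (cyl a b q) < +oo)%E.
Proof.
apply: (@leb3_bounded _ o (a ^+ 2 + b ^+ 2 + q)); first exact: measurable_cyl.
move=> y [az zb tq]; have : axial R o e y ^+ 2 <= a ^+ 2 + b ^+ 2.
  by have [z0|z0] := leP 0 (axial R o e y); nra.
by move: tq; rewrite /transverse; lra.
Qed.

Definition ncyl a b q : R := fine (@leb3 R (cyl a b q)).

Lemma ncylE a b q : @leb3 R (cyl a b q) = (ncyl a b q)%:E.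
Proof.
rewrite /ncyl fineK// ge0_fin_numE; first exact: cyl_fin.
by rewrite leb3E; exact: measure_ge0.
Qed.

Lemma ncyl_ge0 a b q : 0 <= ncyl a b q.
Proof. by apply: fine_ge0; rewrite leb3E; exact: measure_ge0. Qed.

(** Translating by [- t e] lowers the axial coordinate by [t] and keeps the transverse one. *)
Lemma ncyl_translate a b q t : ncyl (a + t) (b + t) q = ncyl a b q.
Proof.
rewrite /ncyl; congr fine.
have := @leb3_affine R (- (t * e.1.1), - (t * e.1.2), - (t * e.2)) 1 ltr01 _
  (measurable_cyl a b q).
rewrite expr1n invr1 mul1e /= => <-; congr (leb3 _).
pose w (y : R3 R) := (- (t * e.1.1) + 1 * y.1.1, - (t * e.1.2) + 1 * y.1.2,
  - (t * e.2) + 1 * y.2).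
have zw y : axial R o e (w y) = axial R o e y - t.
  rewrite -[X in _ = _ - X]mulr1 -[X in _ = _ - _ * X]e1 /axial/=; ring.
have tw y : transverse R o e (w y) = transverse R o e y.
  rewrite /transverse zw.
  have -> : sqdist R o (w y) = sqdist R o y - 2 * t * axial R o e y + t ^+ 2.
    rewrite -[X in _ = _ + X]mulr1 -[X in _ = _ + _ * X]e1 /sqdist /axial/=; ring.
  by ring.
rewrite -/w; apply/seteqP; split=> y; rewrite /cyl/= zw tw.
  by case=> ? ? ?; split=> //; lra.
by case=> ? ? ?; split=> //; lra.
Qed.

(** The homothety of centre [o] and ratio [1/s] divides the axial coordinate by [s] and the
    transverse one, a square, by [s^2]. *)
Lemma ncyl_scale a b q s : 0 < s -> ncyl (s * a) (s * b) (s ^+ 2 * q) = s ^+ 3 * ncyl a b q.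
Proof.
move=> s0; have si : 0 < s^-1 by rewrite invr_gt0.
have sn : s != 0 by rewrite gt_eqF.
have := @leb3_affine R (o.1.1 - s^-1 * o.1.1, o.1.2 - s^-1 * o.1.2, o.2 - s^-1 * o.2)
  s^-1 si _ (measurable_cyl a b q).
rewrite ncylE exprVn invrK -EFinM /= => E.
have {E} : leb3 (cyl (s * a) (s * b) (s ^+ 2 * q)) = (s ^+ 3 * ncyl a b q)%:E.
  rewrite -E; congr (leb3 _).
  pose w (y : R3 R) := (o.1.1 - s^-1 * o.1.1 + s^-1 * y.1.1,
    o.1.2 - s^-1 * o.1.2 + s^-1 * y.1.2, o.2 - s^-1 * o.2 + s^-1 * y.2).
  have zw y : axial R o e (w y) = axial R o e y / s by rewrite /axial/=; ring.
  have tw y : transverse R o e (w y) = transverse R o e y / s ^+ 2.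
    by rewrite /transverse zw /sqdist/axial/=; field.
  rewrite -/w; apply/seteqP; split=> y; rewrite /cyl/= zw tw.
    by rewrite ltr_pdivlMr// ler_pdivrMr// ler_pdivrMr ?exprn_gt0// (mulrC a) (mulrC b) (mulrC q).
  by rewrite ltr_pdivlMr// ler_pdivrMr// ler_pdivrMr ?exprn_gt0// (mulrC a) (mulrC b) (mulrC q).
by rewrite ncylE => -[].
Qed.

Local Opaque ncyl leb3 lebT3.

Lemma ncyl_add a b c q : a <= b -> b <= c -> ncyl a c q = ncyl a b q + ncyl b c q.
Proof.
move=> ab bc; apply: EFin_inj.
rewrite EFinD -(ncylE a c q) -(ncylE a b q) -(ncylE b c q) leb3E.
rewrite -measureU//.
- congr (lebT3 _ _); apply/seteqP; split=> y; rewrite /cyl/=.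
    case=> h1 h2 h3; have [yb|yb] := leP (axial R o e y) b; [left|right]; split=> //.
  by case=> -[h1 h2 h3]; split=> //; lra.
- exact: measurable_cyl.
- exact: measurable_cyl.
- by apply/seteqP; split=> // y [[h1 h2 h3] [h4 h5 h6]]; lra.
Qed.

(** As a function of its length, the volume of a cylinder is nonnegative and additive, hence
    linear. *)
Lemma ncyl_linear a b q : a <= b -> ncyl a b q = (b - a) * ncyl 0 1 q.
Proof.
move=> ab; have -> : ncyl a b q = ncyl 0 (b - a) q.
  by rewrite -(ncyl_translate 0 (b - a) q a) add0r subrK.
apply: (@monotone_additive_linear R (fun x => ncyl 0 x q)).
- by move=> x _; exact: ncyl_ge0.
- move=> x y x0 y0; rewrite (ncyl_add 0 x (x + y))//; last by rewrite lerDl.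
  by rewrite -(ncyl_translate 0 y q x) add0r (addrC y).
- by rewrite subr_ge0.
Qed.

(** The volume of a unit cylinder, that is, pi. It is kept as a symbol throughout. *)
Definition cylconst := ncyl 0 1 1.

(** The homothety of ratio [sqrt q] sends the cylinder of length [1 / sqrt q] and squared radius 1
    to the one of length 1 and squared radius [q]; the volume is multiplied by [q sqrt q], which
    leaves the factor [q]. *)
Lemma ncylP a b q : a <= b -> 0 < q -> ncyl a b q = cylconst * (b - a) * q.
Proof.
move=> ab q0; rewrite ncyl_linear//; have s0 : 0 < Num.sqrt q by rewrite sqrtr_gt0.
have sn : Num.sqrt q != 0 by rewrite gt_eqF.
have := ncyl_scale 0 (Num.sqrt q)^-1 1 (Num.sqrt q) s0.
rewrite mulr0 mulfV// mulr1 sqr_sqrtr ?ltW// => ->.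
rewrite ncyl_linear ?invr_ge0 ?ltW// subr0 /cylconst exprS sqr_sqrtr ?ltW//.
by field.
Qed.

Lemma le_ncyl a b q q' : q <= q' -> ncyl a b q <= ncyl a b q'.
Proof.
move=> qq; rewrite -lee_fin -!ncylE leb3E; apply: le_measure; rewrite ?inE.
- exact: measurable_cyl.
- exact: measurable_cyl.
- by move=> y [h1 h2 h3]; split=> //; exact: le_trans qq.
Qed.

Lemma ncylE_max a b q : a <= b -> ncyl a b q = cylconst * (b - a) * Num.max q 0.
Proof.
move=> ab; have C0 : 0 <= cylconst by exact: ncyl_ge0.
have [q0|q0] := ltP 0 q; first by rewrite ncylP// ?ltW.
rewrite mulr0; apply/eqP; rewrite eq_le ncyl_ge0 andbT.
apply/ler_addgt0Pl => d d0; rewrite addr0.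
(* For [q <= 0] the cylinder lies in each one of squared radius [d / w], whose volume is at most
   [d]; the added 1 keeps the divisor positive. *)
pose w := cylconst * (b - a) + 1.
have w0 : 0 < w by rewrite /w ltr_wpDl// mulr_ge0// subr_ge0.
apply: (@le_trans _ _ (ncyl a b (d / w))).
  by apply: le_ncyl; rewrite (le_trans q0)// divr_ge0 ?ltW.
rewrite ncylP ?divr_gt0// mulrA ler_pdivrMr// mulrC ler_pM2l//.
by rewrite /w lerDl.
Qed.

End Cylinder.

(** * The image of Lebesgue measure under the coordinates [(z, q)] *)

Section PolarMeasure.
Context (R : realType).
Local Notation mR := (measurableTypeR R).
Local Notation T3 := (mR * mR * mR)%type.
Local Notation T2 := (mR * mR)%type.
Local Notation mu := (@lebesgue_measure R).
Local Notation rect := [set A `*` B | A in @ocitv R & B in @ocitv R].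

Definition strip (n : nat) : set mR := [set` `](- n%:R : R), n%:R]].

Lemma ocitv_strip n : ocitv (strip n). Proof. by exists (- n%:R, n%:R). Qed.

Lemma bigcup_strip : \bigcup_n strip n = setT.
Proof.
apply/seteqP; split=> // x _; exists (Num.trunc `|x|).+1 => //=.
have /andP[_ h] := truncn_itv (normr_ge0 x).
by rewrite /strip/= in_itv/=; move: h; rewrite ltr_norml => /andP[-> /ltW ->].
Qed.

(** Both projections are measurable for the sigma-algebra generated by half-open rectangles, because
    [A] times the line is the countable union of the rectangles [A] times a strip. *)
Lemma measurable_rect : @measurable _ T2 = <<s rect >>.
Proof.
pose G := g_sigma_algebraType (rect : set (set T2)).
have ms n : @measurable _ mR (strip n).
  by apply: sub_sigma_algebra; exact: ocitv_strip.
have m1 : measurable_fun setT (fst : G -> mR).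
  apply: (@measurability _ _ _ _ _ _ (@ocitv R)) => //.
  move=> _ [A oA <-]; rewrite setTI.
  have -> : fst @^-1` A = \bigcup_n (A `*` strip n) :> set T2.
    apply/seteqP; split=> -[x y] /=; last by case=> n _ [].
    move=> Ax; have [n _ ny] : (\bigcup_n strip n) y by rewrite bigcup_strip.
    by exists n.
  apply: (@bigcup_measurable _ G) => n _; apply: sub_sigma_algebra.
  by exists A => //; exists (strip n) => //; exact: ocitv_strip.
have m2 : measurable_fun setT (snd : G -> mR).
  apply: (@measurability _ _ _ _ _ _ (@ocitv R)) => //.
  move=> _ [A oA <-]; rewrite setTI.
  have -> : snd @^-1` A = \bigcup_n (strip n `*` A) :> set T2.
    apply/seteqP; split=> -[x y] /=; last by case=> n _ [].
    move=> Ax; have [n _ ny] : (\bigcup_n strip n) x by rewrite bigcup_strip.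
    by exists n.
  apply: (@bigcup_measurable _ G) => n _; apply: sub_sigma_algebra.
  by exists (strip n); [exact: ocitv_strip|exists A].
apply/seteqP; split.
  rewrite measurable_prod_measurableType.
  apply: smallest_sub; first exact: smallest_sigma_algebra.
  move=> _ [A mA [B mB <-]].
  have -> : A `*` B = (fst @^-1` A) `&` (snd @^-1` B) by [].
  have mA' : @measurable _ G (fst @^-1` A) by rewrite -[X in measurable X]setTI; exact: m1.
  have mB' : @measurable _ G (snd @^-1` B) by rewrite -[X in measurable X]setTI; exact: m2.
  exact: (@measurableI _ G _ _ mA' mB').
apply: smallest_sub; first exact: sigma_algebra_measurable.
move=> _ [A mA [B mB <-]].
by apply: measurableX; apply: sub_sigma_algebra.
Qed.

Variables (o e : R3 R).
Hypothesis e1 : e.1.1 ^+ 2 + e.1.2 ^+ 2 + e.2 ^+ 2 = 1.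
Local Notation C := (cylconst R o e).
Definition lower : set T2 := [set x | (x.2 : R) < 0].

Lemma measurable_lower : measurable lower.
Proof.
have -> : lower = setT `*` [set` `]-oo, (0 : R)[].
  by apply/seteqP; split=> x; rewrite /lower/= in_itv/=; [|case].
exact: measurableX.
Qed.

Lemma cylconst_ge0 : 0 <= C. Proof. exact: ncyl_ge0. Qed.

(** A rectangle pulls back to the difference of two cylinders over the same axial range. The outer
    maxima make the formula valid for empty rectangles. *)
Lemma leb3_polar_rect (a b c d : R) :
  @leb3 R (polar R o e @^-1` ([set` `]a, b]] `*` [set` `]c, d]])) =
  (C * Num.max (b - a) 0 * Num.max (Num.max d 0 - Num.max c 0) 0)%:E.
Proof.
have [ab|ab] := ltP a b; last first.
  rewrite (_ : _ @^-1` _ = set0); last first.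
    by apply/seteqP; split=> // y [/=]; rewrite !in_itv/=; lra.
  by rewrite leb3E measure0 max_r ?mulr0 ?mul0r// subr_le0.
have [cd|cd] := leP c d; last first.
  rewrite (_ : _ @^-1` _ = set0); last first.
    by apply/seteqP; split=> // y [/=]; rewrite !in_itv/=; lra.
  rewrite leb3E measure0; congr (_%:E); apply/esym.
  rewrite (@max_r _ _ (Num.max d 0 - Num.max c 0)) ?mulr0// subr_le0.
  by rewrite ge_max le_max (ltW cd)/= le_max lexx orbT.
have -> : polar R o e @^-1` ([set` `]a, b]] `*` [set` `]c, d]]) =
    cyl R o e a b d `\` cyl R o e a b c.
  apply/seteqP; split=> y; rewrite /cyl/= ?in_itv/=.
    case=> /andP[h1 h2] /andP[h3 h4]; split=> // -[_ _]; lra.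
  case=> -[h1 h2 h3] h4; split; apply/andP; split=> //.
  by rewrite ltNge; apply/negP => h5; apply: h4.
transitivity (leb3 (cyl R o e a b d) - leb3 (cyl R o e a b c))%E.
  rewrite -[in RHS](@setIidr _ (cyl R o e a b d) (cyl R o e a b c)); last first.
    by move=> y [h1 h2 h3]; split=> //; exact: le_trans cd.
  by rewrite leb3E; apply: measureD; [exact: measurable_cyl..|exact: cyl_fin].
rewrite !ncylE// !ncylE_max ?ltW// -EFinB; congr (_%:E).
rewrite (@max_l _ _ (b - a)) ?subr_ge0 ?ltW// -mulrBr (@max_l _ _ (_ - _))//.
rewrite subr_ge0 ge_max le_max cd/= le_max lexx orbT//.
Qed.

(** The counterpart of [leb3_polar_rect]: since [max d 0 + min d 0 = d], the two heights add up to
    the height of the whole rectangle. *)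
Lemma leb2_lower_rect (a b c d : R) :
  leb2 R (([set` `]a, b]] `*` [set` `]c, d]]) `&` lower) =
  (Num.max (b - a) 0 * Num.max (Num.min d 0 - Num.min c 0) 0)%:E.
Proof.
have E1 (x y : R) : mu [set` `]x, y]] = (Num.max (y - x) 0)%:E.
  rewrite lebesgue_measure_itv/= lte_fin -EFinD; have [xy|xy] := ltP x y.
    by rewrite max_l// subr_ge0 ltW.
  by rewrite max_r// subr_le0.
have -> : ([set` `]a, b]] `*` [set` `]c, d]]) `&` lower =
    [set` `]a, b]] `*` ([set` `]c, d]] `&` [set` `]-oo, (0:R)[]).
  apply/seteqP; split=> x; rewrite /lower/= !in_itv/=; first by case=> -[].
  by case=> ? [? ?].
transitivity (mu [set` `]a, b]] * mu ([set` `]c, d]] `&` [set` `]-oo, (0%R : R)[]))%E.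
  by apply: product_measure1E => //; apply: measurableI.
rewrite E1 EFinM; congr (_ * _)%E.
have [d0|d0] := ltP d 0.
  rewrite (_ : _ `&` _ = [set` `]c, d]]); last first.
    by apply/seteqP; split=> x /=; rewrite !in_itv/=; [case|move=> h; split=> //; lra].
  rewrite E1; have [c0|c0] := ltP c 0 => //.
  by rewrite max_r ?max_r//; lra.
rewrite (_ : _ `&` _ = [set` `]c, (0:R)[]); last first.
  apply/seteqP; split=> x /=; rewrite !in_itv/=; first by case=> /andP[-> _] ->.
  by case/andP=> h1 h2; split=> //; apply/andP; split=> //; lra.
rewrite lebesgue_measure_itv/= lte_fin -EFinD; have [c0|c0] := ltP c 0.
  by rewrite max_l// sub0r oppr_ge0 ltW.
by rewrite subrr max_r.
Qed.

(* The term on [lower] completes the pushforward to a full Lebesgue measure, so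
   that uniqueness on rectangles applies. *)
Theorem leb3_polar (X : set T2) : measurable X ->
  (@leb3 R (polar R o e @^-1` X) + C%:E * leb2 R (X `&` lower) = C%:E * leb2 R X)%E.
Proof.
move=> mX; have mp := measurable_polar R o e.
pose m1 : {measure set T2 -> \bar R} := mscale (NngNum cylconst_ge0) (leb2 R).
pose m2 : {measure set T2 -> \bar R} := measure_add (image_measure R _ _ _ _ (lebT3 R) _ mp)
  (mscale (NngNum cylconst_ge0) (mrestr (leb2 R) measurable_lower)).
have m1E A : m1 A = (C%:E * leb2 R A)%E by [].
have m2E A : m2 A = (@leb3 R (polar R o e @^-1` A) + C%:E * leb2 R (A `&` lower))%E.
  exact: measure_addE.
suff : m1 X = m2 X by rewrite (m1E X) (m2E X) => ->.
apply: (@measure_unique _ R T2 rect (fun n => strip n `*` strip n) _ _ _ _ m1 m2) => //.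
- exact: measurable_rect.
- move=> _ _ [A oA [B oB <-]] [A' oA' [B' oB' <-]]; rewrite -setXI.
  exists (A `&` A'); first exact: ocitvI.
  by exists (B `&` B') => //; exact: ocitvI.
- by move=> n; exists (strip n); [|exists (strip n)]; try exact: ocitv_strip.
- apply/seteqP; split=> // -[x y] _.
  have /= [n _ nx] : (\bigcup_n strip n) x by rewrite bigcup_strip.
  have /= [k _ ky] : (\bigcup_n strip n) y by rewrite bigcup_strip.
  have sub i j : (i <= j)%N -> strip i `<=` strip j.
    move=> ij z; rewrite /strip/= !in_itv/= => /andP[h1 h2].
    have : i%:R <= j%:R :> R by rewrite ler_nat.
    by move=> h3; apply/andP; split; lra.
  exists (maxn n k) => //; split=> /=.
    by apply: sub nx; exact: leq_maxl.
  by apply: sub ky; exact: leq_maxr.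
- move=> _ [_ [[a b] _ <-] [_ [[c d] _ <-] <-]].
  rewrite [LHS]m1E [RHS]m2E/=.
  rewrite leb3_polar_rect leb2_lower_rect.
  have E1 (x y : R) : mu [set` `]x, y]] = (Num.max (y - x) 0)%:E.
    rewrite lebesgue_measure_itv/= lte_fin -EFinD; have [xy|xy] := ltP x y.
      by rewrite max_l// subr_ge0 ltW.
    by rewrite max_r// subr_le0.
  have -> : leb2 R ([set` `]a, b]] `*` [set` `]c, d]]) =
      (Num.max (b - a) 0 * Num.max (d - c) 0)%:E.
    transitivity (mu [set` `]a, b]] * mu [set` `]c, d]])%E.
      exact: product_measure1E.
    by rewrite !E1.
  rewrite -!EFinM -EFinD; congr (_%:E).
  rewrite -!mulrA -mulrDr -mulrDr; congr (_ * (_ * _)).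
  by have [d0|d0] := leP d 0; have [c0|c0] := leP c 0;
    rewrite ?subr0 ?sub0r ?subrr ?oppr0; repeat (case: leP => ?); lra.
- move=> n; rewrite (m1E (strip n `*` strip n)).
  have -> : leb2 R (strip n `*` strip n) = (mu (strip n) * mu (strip n))%E.
    by apply: product_measure1E; apply: sub_sigma_algebra; exact: ocitv_strip.
  rewrite /strip lebesgue_measure_itv/=.
  by case: ifP => _; rewrite ?mule0 ?ltry// -!EFinD -!EFinM ltry.
Qed.

End PolarMeasure.

(** * Radial integrals over balls *)

Section FTC.
Context (R : realType).
Local Notation mR := (measurableTypeR R).
Local Notation mu := (@lebesgue_measure R).

Lemma is_derive_continuous (F : R -> R) (x df : R) :
  is_derive x 1 F df -> {for x, continuous F}.
Proof. by case=> dF _; exact/differentiable_continuous/derivable1_diffP. Qed.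

Lemma within_itv_continuous (f : R -> R) (a b : R) :
  (forall x, a <= x <= b -> {for x, continuous f}) ->
  {within `[a, b], continuous f}.
Proof.
by move=> cf; apply: continuous_in_subspaceT => x; rewrite inE/= in_itv/=; exact: cf.
Qed.

(** End points carry no mass, so one statement, with the derivative given on the closed interval,
    serves for every kind of interval. *)
Lemma integral_itv_derive (f F : R -> R) (a b : R) (c1 c2 : bool) : a < b ->
  (forall x, a <= x <= b -> is_derive x 1 F (f x)) ->
  (forall x, a <= x <= b -> {for x, continuous f}) ->
  (\int[mu]_(x in [set` Interval (BSide c1 a) (BSide c2 b)]) (f x)%:E = (F b - F a)%:E)%E.
Proof.
move=> ab dF cf.
have wf := within_itv_continuous f a b cf.
have mf : measurable_fun `]a, b[ (EFin \o f).
  apply/measurable_EFinP; apply: (@measurable_funS _ _ _ _ `[a, b]) => //.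
    by move=> x /=; rewrite !in_itv/= => /andP[/ltW -> /ltW ->].
  exact: subspace_continuous_measurable_fun.
rewrite (integral_itv_bndoo _ _ mf) -(integral_itv_bndoo true false mf).
rewrite (@continuous_FTC2 _ f F)//.
- split.
  + by move=> x; rewrite in_itv/= => /andP[ax xb]; have [] := dF x; rewrite ?ltW.
  + apply/cvg_at_right_filter; apply: (@is_derive_continuous _ _ (f a)).
    by apply: dF; rewrite lexx ltW.
  + apply/cvg_at_left_filter; apply: (@is_derive_continuous _ _ (f b)).
    by apply: dF; rewrite lexx ltW.
- move=> x; rewrite in_itv/= => /andP[ax xb]; rewrite derive1E.
  by have [] := dF x; rewrite ?ltW.
Qed.

End FTC.

Section PolarIntegral.
Context (R : realType).
Local Notation mR := (measurableTypeR R).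
Local Notation T3 := (mR * mR * mR)%type.
Local Notation T2 := (mR * mR)%type.
Local Notation mu := (@lebesgue_measure R).
Variables (o e : R3 R).
Hypothesis e1 : e.1.1 ^+ 2 + e.1.2 ^+ 2 + e.2 ^+ 2 = 1.
Local Notation C := (cylconst R o e).

(** The image of the coordinate map avoids [lower]; on the complement, [leb3_polar] identifies the
    image measure with [C] times plane measure, and Tonelli's theorem splits the integral. *)
Lemma ge0_integral_polar (h : T2 -> \bar R) :
  measurable_fun setT h -> (forall x, 0 <= h x)%E ->
  (\int[lebT3 R]_y h (polar R o e y) =
   C%:E * \int[mu]_z \int[mu]_(q in `[0%R, +oo[) h (z, q))%E.
Proof.
move=> mh h0.
have mp := measurable_polar R o e.
have mL := measurable_lower R.
have mU : measurable (~` lower R) by exact: measurableC.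
have pU : polar R o e @^-1` (~` lower R) = setT.
  apply/seteqP; split=> // y _; rewrite /lower/=.
  by apply/negP; rewrite -leNgt; exact: transverse_ge0.
have C0 := cylconst_ge0 R o e.
transitivity (\int[image_measure R _ _ _ _ (lebT3 R) _ mp]_(x in ~` lower R) h x)%E.
  rewrite -[in LHS]pU.
  symmetry; apply: (ge0_integral_pushforward mp) => //.
  - by apply: measurable_funTS.
transitivity (\int[mscale (NngNum C0) (leb2 R)]_(x in ~` lower R) h x)%E.
  apply: eq_measure_integral => A mA AU.
  have := leb3_polar R o e e1 A mA.
  rewrite (_ : A `&` lower R = set0); last first.
    by apply/seteqP; split=> // x [/AU].
  by rewrite measure0 mule0 adde0 => E; exact: E.
rewrite ge0_integral_mscale//; last by apply: measurable_funTS.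
congr (_ * _)%E; rewrite integral_mkcond.
have mhU : measurable_fun setT (h \_ (~` lower R)).
  by apply/measurable_restrict => //; apply: measurable_funTS.
have h0U x : (0 <= (h \_ (~` lower R)) x)%E.
  by rewrite patchE; case: ifP.
transitivity (\int[mu]_z \int[mu]_q (h \_ (~` lower R)) (z, q))%E.
  exact: fubini_tonelli1.
apply: eq_integral => z _; rewrite [RHS]integral_mkcond.
apply: eq_integral => q _; rewrite !patchE; congr (if _ then _ else _).
apply/idP/idP; rewrite !inE/= in_itv/= andbT /lower/= => hq.
  by rewrite leNgt; apply/negP.
by apply/negP; rewrite -leNgt.
Qed.

End PolarIntegral.

(** * A radial kernel integrated over a ball around an inner point *)

Section BallIntegral.
Context (R : realType).
Local Notation mR := (measurableTypeR R).
Local Notation T3 := (mR * mR * mR)%type.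
Local Notation T2 := (mR * mR)%type.
Local Notation mu := (@lebesgue_measure R).

Lemma lebT3_mkcond (D : set T3) (f : T3 -> \bar R) :
  (\int[lebT3 R]_(y in D) f y = \int[lebT3 R]_y (f \_ D) y)%E.
Proof. exact: integral_mkcond. Qed.

Lemma dist3E (x y : R3 R) : dist3 y x = Num.sqrt (sqdist R x y). Proof. by []. Qed.

Lemma dist3_ge0 (x y : R3 R) : 0 <= dist3 x y. Proof. exact: sqrtr_ge0. Qed.

Lemma measurable_fun_sqrt d (T : measurableType d) (f : T -> R) :
  measurable_fun setT f -> measurable_fun setT (fun x => Num.sqrt (f x)).
Proof.
move=> mf; apply: (measurableT_comp _ mf); apply: continuous_measurable_fun.
exact: sqrt_continuous.
Qed.

(** Inversion is not continuous at 0, but on nonnegative reals it is the power of exponent [-1],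
    including the value 0 at 0, and powers are measurable. *)
Lemma measurable_fun_inv_ge0 d (T : measurableType d) (f : T -> R) :
  (forall x, 0 <= f x) ->
  measurable_fun setT f -> measurable_fun setT (fun x => (f x)^-1).
Proof.
move=> f0 mf; rewrite (_ : (fun x => _) = (@powR R ^~ (-1)) \o f); last first.
  by apply/funext => x /=; rewrite powR_inv1.
exact: measurableT_comp.
Qed.

Lemma measurable_radial d (T : measurableType d) (g : R -> R) (f : T -> R) :
  continuous g -> measurable_fun setT f ->
  measurable_fun setT (fun x => g (Num.sqrt (f x)) / Num.sqrt (f x)).
Proof.
move=> cg mf; have ms := measurable_fun_sqrt _ _ _ mf.
apply: measurable_funM.
  by apply: (measurableT_comp _ ms); exact: continuous_measurable_fun.
by apply: measurable_fun_inv_ge0 => // x; exact: sqrtr_ge0.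
Qed.

Lemma measurable_dist3 (x : R3 R) : measurable_fun setT (fun y : T3 => dist3 y x).
Proof. by apply: measurable_fun_sqrt; exact: measurable_sqdist. Qed.

Lemma measurable_ball3 (x : R3 R) r : measurable (ball3 x r : set T3).
Proof.
have -> : ball3 x r = (fun y : T3 => dist3 y x) @^-1` [set` `]-oo, r[].
  by apply/seteqP; split=> y; rewrite /ball3/= in_itv.
by rewrite -[X in measurable X]setTI; exact: measurable_dist3.
Qed.

Lemma measurable_dist_kernel (g : R -> R) (x : R3 R) : continuous g ->
  measurable_fun setT (fun y : T3 => g (dist3 y x) / dist3 y x).
Proof. by move=> cg; apply: measurable_radial => //; exact: measurable_sqdist. Qed.

(** Setting: [x] is the origin of the coordinates, and the ball of radius [r] has its centre on the
    axis at height [rho]; below, [W] is this ball in the coordinates [(z, q)]. A point of the sphere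
    at height [z] has [q = r^2 - (z - rho)^2], hence its distance to [x] is [U z]. The first
    antiderivative [G] serves the integral in [q]; [K] and [V] serve the integral in [z]. *)
Variables (g G K V : R -> R) (rho r : R).
Hypotheses (g0 : forall u : R, 0 <= u -> 0 <= g u) (cg : continuous g).
Hypotheses (dG : forall u : R, is_derive u 1 G (g u))
  (dK : forall u : R, is_derive u 1 K (G u)).
Hypotheses (rho0 : 0 <= rho) (rhor : rho < r).
Local Notation U := (fun z : R => Num.sqrt (r ^+ 2 - rho ^+ 2 + 2 * rho * z)).
Hypothesis dV : forall z : R, rho - r <= z <= rho + r -> is_derive z 1 V (G (U z)).

Let kern (x : T2) : R :=
  g (Num.sqrt (x.1 ^+ 2 + x.2)) / Num.sqrt (x.1 ^+ 2 + x.2).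
Let W : set T2 := [set x | (x.1 - rho) ^+ 2 + x.2 < r ^+ 2].
Let h := (EFin \o kern) \_ W.

Let m1 : measurable_fun setT (fun x : T2 => x.1 : R).
Proof. exact: measurable_fst. Qed.

Let m2 : measurable_fun setT (fun x : T2 => x.2 : R).
Proof. exact: measurable_snd. Qed.

Let mkern : measurable_fun setT kern.
Proof.
apply: measurable_radial => //; apply: measurable_funD => //.
exact: measurable_funX.
Qed.

Let mW : measurable W.
Proof.
pose w (x : T2) : R := (x.1 - rho) ^+ 2 + x.2.
have mw : measurable_fun setT w.
  apply: measurable_funD => //; apply: measurable_funX.
  exact: measurable_funB.
have -> : W = w @^-1` [set` `]-oo, r ^+ 2[].
  by apply/seteqP; split=> x; rewrite /W/= in_itv.
by rewrite -[X in measurable X]setTI; exact: mw.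
Qed.

Let kern0 x : 0 <= kern x.
Proof. by rewrite divr_ge0 ?g0// ?sqrtr_ge0. Qed.

Let mh : measurable_fun setT h.
Proof.
by apply/measurable_restrict => //; apply: measurable_funTS; apply/measurable_EFinP.
Qed.

Let h0 x : (0 <= h x)%E.
Proof. by rewrite /h patchE; case: ifP => // _; rewrite lee_fin. Qed.

Let inner z : \bar R := (\int[mu]_(q in `[0%R, +oo[) h (z, q))%E.

Let minner : measurable_fun setT inner.
Proof.
have mU : measurable (~` lower R) by apply: measurableC; exact: measurable_lower.
have mhU : measurable_fun setT (h \_ (~` lower R)).
  by apply/measurable_restrict => //; apply: measurable_funTS.
have h0U x : (0 <= (h \_ (~` lower R)) x)%E.
  by rewrite patchE; case: ifP.
rewrite (_ : inner = fubini_F mu (h \_ (~` lower R))).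
  exact: measurable_fun_fubini_tonelli_F.
apply/funext => z; symmetry; rewrite /inner [RHS]integral_mkcond.
apply: eq_integral => q _; rewrite !patchE; congr (if _ then _ else _).
apply/idP/idP; rewrite !inE/= in_itv/= andbT /lower/= => hq.
  by rewrite leNgt; apply/negP.
by apply/negP; rewrite -leNgt.
Qed.

Let inner_out z : r <= `|z - rho| -> inner z = 0%E.
Proof.
move=> zr; apply: integral0_eq => q; rewrite /= in_itv/= andbT => q0.
rewrite /h patchE ifF//; apply/negbTE/negP; rewrite inE /W/=.
have : r ^+ 2 <= (z - rho) ^+ 2.
  by rewrite -(real_normK (num_real (z - rho))) lerXn2r ?nnegrE// (le_trans rho0)// ltW.
lra.
Qed.

(** In [q], the integrand has the antiderivative [2 G(sqrt(z^2 + q))]. With [z != 0] the radicand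
    stays positive up to [q = 0], where the square root must be differentiated. *)
Let inner_in z : `|z - rho| < r -> z != 0 ->
  inner z = (2 * (G (U z) - G `|z|))%:E.
Proof.
move=> zr zn; set Q := r ^+ 2 - (z - rho) ^+ 2.
have Q0 : 0 < Q.
  by rewrite /Q subr_gt0 -(real_normK (num_real (z - rho))) ltrXn2r// nnegrE (le_trans rho0)// ltW.
have z2 : 0 < z ^+ 2 by rewrite exprn_even_gt0.
have s0 q : 0 <= q <= Q -> 0 < z ^+ 2 + q by move=> /andP[? _]; rewrite ltr_pwDl.
have -> : inner z = (\int[mu]_(q in `[0%R, Q[) (g (Num.sqrt (z ^+ 2 + q)) /
    Num.sqrt (z ^+ 2 + q))%:E)%E.
  rewrite /inner integral_mkcond [RHS]integral_mkcond; apply: eq_integral => q _.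
  have E1 : (q \in `[0%R, +oo[%classic) = (0 <= q) by rewrite mem_setE in_itv/= andbT.
  have E2 : (q \in `[0%R, Q[%classic) = (0 <= q < Q) by rewrite mem_setE in_itv.
  rewrite /h !patchE E1 E2.
  have [q0|//] := boolP (0 <= q); rewrite -/(kern (z, q)).
  have -> : ((z, q) \in W) = (q < Q); last by case: ifP.
  apply/idP/idP; first by rewrite inE /W/= /Q; lra.
  by move=> qQ; rewrite inE /W/=; move: qQ; rewrite /Q; lra.
have hd (q : R) : 0 <= q <= Q -> is_derive q 1 (fun q => 2 * G (Num.sqrt (z ^+ 2 + q)))
    (g (Num.sqrt (z ^+ 2 + q)) / Num.sqrt (z ^+ 2 + q)).
  move=> qQ; have sq := s0 q qQ.
  have d1 : is_derive q 1 (fun q : R => z ^+ 2 + q) 1.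
    exact: (@is_derive_eq _ _ _ _ _ _ _ _
      (is_deriveD (is_derive_cst (z ^+ 2) q 1) (is_derive_id q 1)) (add0r 1)).
  have d2 := @is_derive1_comp _ Num.sqrt (fun q : R => z ^+ 2 + q) q _ _
     (is_derive1_sqrt sq) d1.
  have d3 := @is_derive1_comp _ G _ q _ _ (dG _) d2.
  apply: (@is_derive_eq _ _ _ _ _ _ _ _ (@is_deriveZ _ _ _ _ 2 _ _ _ d3)).
  rewrite /GRing.scale/= mulr1.
  by field; rewrite gt_eqF ?sqrtr_gt0.
have hc (q : R) : 0 <= q <= Q ->
    {for q, continuous (fun q => g (Num.sqrt (z ^+ 2 + q)) / Num.sqrt (z ^+ 2 + q))}.
  move=> qQ; have sq := s0 q qQ.
  have cs : {for q, continuous (fun q : R => Num.sqrt (z ^+ 2 + q))}.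
    apply: (@continuous_comp _ _ _ (fun q : R => z ^+ 2 + q) Num.sqrt).
      by apply: continuousD; [exact: cst_continuous|exact: cvg_id].
    exact: sqrt_continuous.
  apply: continuousM.
    by apply: (@continuous_comp _ _ _ _ g _ cs); exact: cg.
  by apply: continuousV => //; rewrite gt_eqF// sqrtr_gt0.
rewrite (integral_itv_derive _ _ _ _ _ true true Q0 hd hc).
rewrite addr0 sqrtr_sqr -mulrBr; congr (_ * (G (Num.sqrt _) - _))%:E.
by rewrite /Q; ring.
Qed.

Let cU z : {for z, continuous U}.
Proof.
apply: (@continuous_comp _ _ _ (fun z : R => r ^+ 2 - rho ^+ 2 + 2 * rho * z) Num.sqrt).
  apply: continuousD; first exact: cst_continuous.
  by apply: continuousM; [exact: cst_continuous|exact: cvg_id].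
exact: sqrt_continuous.
Qed.

Let cG u : {for u, continuous G}.
Proof. exact: is_derive_continuous (dG u). Qed.

Lemma integral_inner : (\int[mu]_z inner z)%E =
  (2 * (V (rho + r) - V (rho - r) - K (rho + r) - K (r - rho) + 2 * K 0))%:E.
Proof.
have inner0 z : (0 <= inner z)%E by apply: integral_ge0.
have rr : rho < r := rhor.
have lo : rho - r < 0 by lra.
have hi : 0 < rho + r by rewrite ltr_wpDl// (le_lt_trans rho0).
(* The cut at 0 resolves [|z|]: the antiderivative is [V z + K (- z)] on the left and [V z - K z] on
   the right. The values of [V] at 0 cancel and those of [K] add to [2 K 0]. *)
transitivity (\int[mu]_(z in `](rho - r)%R, 0%R[ `|` `[0%R, (rho + r)%R[) inner z)%E.
  rewrite [RHS]integral_mkcond; apply: eq_integral => z _; rewrite patchE.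
  case: ifPn => //; rewrite notin_setE => zn; apply: inner_out.
  rewrite leNgt ltr_norml; apply/negP => /andP[z1 z2]; apply: zn.
  by have [z0|z0] := ltP z 0; [left|right]; rewrite /= in_itv/=; apply/andP; split; lra.
rewrite ge0_integral_setU//=; last 2 first.
- by apply: measurable_funTS.
- apply/disj_setPRL => z/=; rewrite !in_itv/= => /andP[z1 z2] /andP[z3 z4]; lra.
rewrite -(@integral_itv_obnd_cbnd _ 0); last by apply: measurable_funTS.
have cGU (z : R) : {for z, continuous (fun z => G (U z))}.
  by apply: (@continuous_comp _ _ _ U G); [exact: cU|exact: cG].
have hd1 (z : R) : rho - r <= z <= 0 ->
    is_derive z 1 (fun z => 2 * (V z + K (- z))) (2 * (G (U z) - G (- z))).
  move=> zz.
  have d1 := @is_derive1_comp _ K _ z _ _ (dK _) (is_deriveN (is_derive_id z 1)).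
  have d0 : is_derive z 1 V (G (U z)) by apply: dV; lra.
  apply: (@is_derive_eq _ _ _ _ _ _ _ _ (@is_deriveZ _ _ _ _ 2 _ _ _ (is_deriveD d0 d1))).
  by rewrite /GRing.scale/=; ring.
have hc1 (z : R) : rho - r <= z <= 0 ->
    {for z, continuous (fun z => 2 * (G (U z) - G (- z)))}.
  move=> _; apply: continuousM; first exact: cst_continuous.
  apply: continuousB; first exact: cGU.
  apply: (@continuous_comp _ _ _ (fun z : R => - z) G); last exact: cG.
  by apply: continuousN; exact: cvg_id.
have -> : (\int[mu]_(z in `](rho - r)%R, 0%R[) inner z)%E =
    (2 * (V 0 + K (- 0)) - 2 * (V (rho - r) + K (- (rho - r))))%:E.
  rewrite -(integral_itv_derive _ _ _ _ _ false true lo hd1 hc1).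
  apply: eq_integral => z; rewrite inE/= in_itv/= => /andP[z1 z2].
  rewrite inner_in//; [by rewrite ltr0_norm| |by rewrite lt_eqF].
  by rewrite ltr_norml; apply/andP; split; lra.
have hd2 (z : R) : 0 <= z <= rho + r ->
    is_derive z 1 (fun z => 2 * (V z - K z)) (2 * (G (U z) - G z)).
  move=> zz; have d0 : is_derive z 1 V (G (U z)) by apply: dV; lra.
  exact: (@is_deriveZ _ _ _ _ 2 _ _ _ (is_deriveB d0 (dK z))).
have hc2 (z : R) : 0 <= z <= rho + r ->
    {for z, continuous (fun z => 2 * (G (U z) - G z))}.
  move=> _; apply: continuousM; first exact: cst_continuous.
  by apply: continuousB; [exact: cGU|exact: cG].
have -> : (\int[mu]_(z in `]0%R, (rho + r)%R[) inner z)%E =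
    (2 * (V (rho + r) - K (rho + r)) - 2 * (V 0 - K 0))%:E.
  rewrite -(integral_itv_derive _ _ _ _ _ false true hi hd2 hc2).
  apply: eq_integral => z; rewrite inE/= in_itv/= => /andP[z1 z2].
  rewrite inner_in//; [by rewrite gtr0_norm| |by rewrite gt_eqF].
  by rewrite ltr_norml; apply/andP; split; lra.
rewrite -EFinD oppr0 opprB; congr (_%:E); ring.
Qed.

Variables (x x0 e : R3 R).
Hypothesis e1 : e.1.1 ^+ 2 + e.1.2 ^+ 2 + e.2 ^+ 2 = 1.
Hypothesis x0E : x0 = (x.1.1 + rho * e.1.1, x.1.2 + rho * e.1.2, x.2 + rho * e.2).

(** In coordinates centred at [x], the distance to [x] is [sqrt(z^2 + q)] and the squared distance
    to [x0] is [(z - rho)^2 + q], so the ball becomes [W] and the kernel becomes [kern]. *)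
Lemma ge0_integral_ball3 :
  (\int[lebT3 R]_(y in (ball3 x0 r : set T3)) (g (dist3 y x) / dist3 y x)%:E =
  (cylconst R x e *
    (2 * (V (rho + r) - V (rho - r) - K (rho + r) - K (r - rho) + 2 * K 0)))%:E)%E.
Proof.
rewrite EFinM -integral_inner -(ge0_integral_polar R x e e1 h mh h0).
transitivity (\int[lebT3 R]_y ((fun y : T3 => (g (dist3 y x) / dist3 y x)%:E)
    \_ (ball3 x0 r : set T3)) y)%E; first exact: lebT3_mkcond.
apply: eq_integral => y _.
rewrite /h !patchE /polar/=.
have -> : kern (axial R x e y, transverse R x e y) = g (dist3 y x) / dist3 y x.
  by rewrite /kern/= /transverse addrC subrK.
congr (if _ then _ else _).
have E : (axial R x e y - rho) ^+ 2 + transverse R x e y = sqdist R x0 y.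
  rewrite /transverse x0E.
  transitivity (sqdist R x y - 2 * rho * axial R x e y + rho ^+ 2 * 1); first by ring.
  by rewrite -[X in _ + _ * X]e1 /sqdist/axial/=; ring.
have r0 : 0 < r by exact: le_lt_trans rhor.
have B : (dist3 y x0 < r) = (sqdist R x0 y < r ^+ 2).
  rewrite dist3E -[X in _ < X]ger0_norm ?ltW// -sqrtr_sqr ltr_sqrt//.
  by rewrite exprn_gt0.
apply/idP/idP; rewrite !inE /ball3 /W/= E; first by rewrite B.
by rewrite -B.
Qed.

End BallIntegral.

(** * Differentiation rules on explicit functions *)

Section Derive.
Context (R : realType).
Implicit Types (f g : R -> R) (x : R).

(** Turns the agreement of functions and of derivatives into side goals, so that the rules below
    apply up to algebra. *)
Lemma deriv_eq f g x df dg : is_derive x 1 f df -> f =1 g -> df = dg -> is_derive x 1 g dg.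
Proof. by move=> h /funext <- <-. Qed.

Lemma deriv_id x : is_derive x 1 (fun u : R => u) 1.
Proof. exact: is_derive_id. Qed.

Lemma deriv_cst (c : R) x : is_derive x 1 (fun _ : R => c) 0.
Proof. exact: is_derive_cst. Qed.

Lemma deriv_add f g x df dg : is_derive x 1 f df -> is_derive x 1 g dg ->
  is_derive x 1 (fun u => f u + g u) (df + dg).
Proof. exact: is_deriveD. Qed.

Lemma deriv_opp f x df : is_derive x 1 f df -> is_derive x 1 (fun u => - f u) (- df).
Proof. exact: is_deriveN. Qed.

Lemma deriv_mul f g x df dg : is_derive x 1 f df -> is_derive x 1 g dg ->
  is_derive x 1 (fun u => f u * g u) (f x * dg + g x * df).
Proof. exact: is_deriveM. Qed.

Lemma deriv_scale (c : R) f x df : is_derive x 1 f df ->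
  is_derive x 1 (fun u => c * f u) (c * df).
Proof. exact: is_deriveZ. Qed.

Lemma deriv_compose f g x df dg : is_derive (g x) 1 f df -> is_derive x 1 g dg ->
  is_derive x 1 (fun u => f (g u)) (df * dg).
Proof. exact: is_derive1_comp. Qed.

Lemma deriv_inv f x df : f x != 0 -> is_derive x 1 f df ->
  is_derive x 1 (fun u => (f u)^-1) (- f x ^- 2 * df).
Proof. exact: is_deriveV. Qed.

Lemma deriv_linear (c x : R) : is_derive x 1 (fun u : R => c * u) c.
Proof. by apply: deriv_eq (deriv_scale c _ _ _ (deriv_id x)) _ _ => //; rewrite mulr1. Qed.

Lemma deriv_sin (c x : R) : is_derive x 1 (fun u => sin (c * u)) (c * cos (c * x)).
Proof.
by apply: deriv_eq (deriv_compose _ _ _ _ _ (is_derive_sin (c * x)) (deriv_linear c x)) _ _ => //;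
  rewrite mulrC.
Qed.

Lemma deriv_cos (c x : R) : is_derive x 1 (fun u => cos (c * u)) (- (c * sin (c * x))).
Proof.
by apply: deriv_eq (deriv_compose _ _ _ _ _ (is_derive_cos (c * x)) (deriv_linear c x)) _ _ => //;
  rewrite mulrC mulrN.
Qed.

Lemma deriv_pow n x : is_derive x 1 (fun u : R => u ^+ n.+1) (n.+1%:R * x ^+ n).
Proof.
elim: n => [|n IH].
  by apply: deriv_eq (deriv_id x) _ _ => [u|]; rewrite ?expr1// expr0 mulr1.
apply: deriv_eq (deriv_mul _ _ _ _ _ (deriv_id x) IH) _ _ => [u|]; first by rewrite -exprS.
by rewrite mulr1 -(natr1 n.+1) (exprS x n); ring.
Qed.

End Derive.

(** * Volumes of balls and potentials by antiderivatives *)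

Section BallPotential.
Context (R : realType).
Local Notation mR := (measurableTypeR R).
Local Notation T3 := (mR * mR * mR)%type.
Local Notation mu := (@lebesgue_measure R).

Lemma set1_T3 (x : R3 R) : [set x] = [set x.1.1] `*` [set x.1.2] `*` [set x.2].
Proof.
case: x => -[a b] c /=; apply/seteqP; split=> y /=; first by move=> ->.
by case: y => -[? ?] ?/= [[-> ->] ->].
Qed.

Lemma measurable_set1_T3 (x : R3 R) : measurable ([set x] : set T3).
Proof.
by rewrite set1_T3; apply: measurableX; [apply: measurableX|]; exact: measurable_set1.
Qed.

Lemma lebT3_set1 (x : R3 R) : lebT3 R [set x] = 0%E.
Proof.
have := leb3_box R x.1.1 x.1.1 x.1.2 x.1.2 x.2 x.2.
by rewrite !set_itv1 !lebesgue_measure_set1 !mule0 leb3E -set1_T3.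
Qed.

Lemma lebT3_setD1 (x : R3 R) (A : set T3) : measurable A ->
  lebT3 R (A `\` [set x]) = lebT3 R A.
Proof.
move=> mA; have m1 := measurable_set1_T3 x.
have mD : measurable (A `\` [set x]) by exact: measurableD.
apply/eqP; rewrite eq_le; apply/andP; split.
  by apply: le_measure; rewrite ?inE//; exact: subDsetl.
apply: (@le_trans _ _ (lebT3 R (A `\` [set x]) + lebT3 R [set x])%E).
  apply: (@le_trans _ _ (lebT3 R ((A `\` [set x]) `|` [set x]))).
    apply: le_measure; rewrite ?inE//; first exact: measurableU.
    by move=> y yB; have [->|yx] := eqVneq y x; [right|left; split=> //; exact/eqP].
  exact: measureU2.
by rewrite lebT3_set1 adde0.
Qed.

Lemma sqdist_eq0 (x y : R3 R) : sqdist R x y = 0 -> y = x.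
Proof.
case: x y => -[x1 x2] x3 [[y1 y2] y3]; rewrite /sqdist/= => h.
have s1 := sqr_ge0 (y1 - x1); have s2 := sqr_ge0 (y2 - x2); have s3 := sqr_ge0 (y3 - x3).
have z (a b : R) : (a - b) ^+ 2 = 0 -> a = b.
  by move=> /eqP; rewrite sqrf_eq0 subr_eq0 => /eqP.
congr (_, _, _); apply: z; lra.
Qed.

Lemma sqdist_ge0 (x y : R3 R) : 0 <= sqdist R x y.
Proof. by rewrite /sqdist !addr_ge0 ?sqr_ge0. Qed.

Lemma dist3_eq0 (x y : R3 R) : (dist3 y x == 0) = (y == x).
Proof.
apply/eqP/eqP => [|->]; last by rewrite dist3E /sqdist !subrr expr0n/= !addr0 sqrtr0.
move/eqP; rewrite dist3E sqrtr_eq0 => h; apply: sqdist_eq0.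
by apply/eqP; rewrite eq_le h sqdist_ge0.
Qed.

Lemma dist3C (x y : R3 R) : dist3 x y = dist3 y x.
Proof. by rewrite /dist3; congr Num.sqrt; ring. Qed.

(** The integral formula is applied with [g] the identity and [rho = 0]: the kernel [d / d] is 1
    except at the centre, where division by zero gives 0, and a point is negligible. *)
Lemma lebT3_ball (x e : R3 R) (r : R) : e.1.1 ^+ 2 + e.1.2 ^+ 2 + e.2 ^+ 2 = 1 -> 0 < r ->
  lebT3 R (ball3 x r) = (4 / 3 * cylconst R x e * r ^+ 3)%:E.
Proof.
move=> e1 r0.
have dG (u : R) : is_derive u 1 (fun u => 2^-1 * u ^+ 2) u.
  by apply: deriv_eq (deriv_scale _ 2^-1 _ _ _ (deriv_pow _ 1 u)) _ _ => //; field.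
have dK (u : R) : is_derive u 1 (fun u => 6^-1 * u ^+ 3) (2^-1 * u ^+ 2).
  by apply: deriv_eq (deriv_scale _ 6^-1 _ _ _ (deriv_pow _ 2 u)) _ _ => //; field.
have dV (z : R) : 0 - r <= z <= 0 + r -> is_derive z 1 (fun z => 2^-1 * r ^+ 2 * z)
    (2^-1 * (Num.sqrt (r ^+ 2 - 0 ^+ 2 + 2 * 0 * z)) ^+ 2).
  move=> _; apply: deriv_eq (deriv_linear _ (2^-1 * r ^+ 2) z) _ _ => //.
  by rewrite expr0n/= subr0 mulr0 mul0r addr0 sqrtr_sqr real_normK ?num_real.
have xE : x = (x.1.1 + 0 * e.1.1, x.1.2 + 0 * e.1.2, x.2 + 0 * e.2).
  by rewrite !mul0r !addr0; case: x => -[].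
have := @ge0_integral_ball3 R id _ _ _ 0 r (fun u h => h) (fun u => cvg_id)
  dG dK (lexx 0) r0 dV x x e e1 xE.
set S := (X in _ = X%:E -> _) => E.
have mB := measurable_ball3 R x r.
have mB1 : measurable (ball3 x r `\` [set x] : set T3).
  by apply: measurableD => //; exact: measurable_set1_T3.
rewrite -(lebT3_setD1 x)//.
transitivity (\int[lebT3 R]_(y in (ball3 x r : set T3)) (dist3 y x / dist3 y x)%:E)%E.
  transitivity (\int[lebT3 R]_(y in (ball3 x r : set T3))
    (\1_(ball3 x r `\` [set x] : set T3) y)%:E)%E.
    by rewrite integral_indic// setIidl.
  apply: eq_integral => y; rewrite inE => yB; congr (_%:E).
  rewrite indicE; have [yx|yx] := eqVneq y x.
    have -> : (y \in (ball3 x r `\` [set x] : set T3)) = false.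
      by apply/negbTE; rewrite notin_setE => -[_]; apply.
    have /eqP -> : dist3 y x == 0 by rewrite dist3_eq0 yx.
    by rewrite mul0r.
  have -> : (y \in (ball3 x r `\` [set x] : set T3)).
    by apply/mem_set; split=> //; exact/eqP.
  by rewrite divff// dist3_eq0.
rewrite E /S expr0n/=; congr (_%:E).
by field.
Qed.


Definition origin : R3 R := ((0, 0), 0).
Definition e3 : R3 R := ((0, 0), 1).
Definition polarconst : R := cylconst R origin e3.

Local Opaque cylconst.

Lemma e3_unit : e3.1.1 ^+ 2 + e3.1.2 ^+ 2 + e3.2 ^+ 2 = 1.
Proof. by rewrite /e3/= expr0n expr1n/= !add0r. Qed.

(** The volume of a unit ball, computed along any axis through its centre, determines the constant;
    a translation carries one centre to the other. *)
Lemma cylconstE (x e : R3 R) : e.1.1 ^+ 2 + e.1.2 ^+ 2 + e.2 ^+ 2 = 1 ->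
  cylconst R x e = polarconst.
Proof.
move=> e1; have := lebT3_ball x e 1 e1 ltr01.
have := lebT3_ball origin e3 1 e3_unit ltr01.
have := @leb3_affine R (- x.1.1, - x.1.2, - x.2) 1 ltr01 _ (measurable_ball3 R origin 1).
rewrite expr1n invr1 mul1e leb3E => <-.
rewrite (_ : _ @^-1` _ = ball3 x 1); last first.
  have E (y : R3 R) : dist3 (- x.1.1 + 1 * y.1.1, - x.1.2 + 1 * y.1.2, - x.2 + 1 * y.2) origin
      = dist3 y x.
    by rewrite /dist3/=; congr Num.sqrt; ring.
  by apply/seteqP; split=> y; rewrite /ball3/= E.
by move=> -> [] ; rewrite -/polarconst; lra.
Qed.

Lemma lebT3_ball3 (x : R3 R) (r : R) : 0 < r ->
  lebT3 R (ball3 x r) = (4 / 3 * polarconst * r ^+ 3)%:E.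
Proof. by move=> r0; have := lebT3_ball x e3 r e3_unit r0; rewrite (cylconstE x e3 e3_unit). Qed.

(** Otherwise the ball of radius 2 would be null, although it contains the unit cube, whose diagonal
    is [sqrt 3]. *)
Lemma polarconst_gt0 : 0 < polarconst.
Proof.
rewrite lt_neqAle cylconst_ge0 andbT eq_sym; apply/eqP => c0.
have := lebT3_ball3 origin 2 (ltr0Sn _ _); rewrite c0 mulr0 mul0r => B0.
have : (lebT3 R ([set` `[0%R : R, 1%R]] `*` [set` `[0%R : R, 1%R]] `*` [set` `[0%R : R, 1%R]]) <= 0)%E.
  apply: (@le_trans _ _ (lebT3 R (ball3 origin 2))); last by rewrite B0.
  apply: le_measure; rewrite ?inE; [|exact: measurable_ball3|].
    by apply: measurableX => //; apply: measurableX.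
  move=> y /= [[]]; rewrite !in_itv/= => /andP[a1 a2] /andP[b1 b2] /andP[d1 d2].
  rewrite /ball3/= dist3E /sqdist/= !subr0 -[X in _ < X]ger0_norm// -sqrtr_sqr ltr_sqrt; nra.
have := leb3_box R 0 1 0 1 0 1; rewrite leb3E => ->.
rewrite !lebesgue_measure_itv/= !lte_fin !ltr01 -!EFinD -!EFinM lee_fin.
by rewrite !subr0 !mulr1 ler10.
Qed.

Lemma exists_direction (x x0 : R3 R) : exists2 e : R3 R,
  e.1.1 ^+ 2 + e.1.2 ^+ 2 + e.2 ^+ 2 = 1 &
  x0 = (x.1.1 + dist3 x0 x * e.1.1, x.1.2 + dist3 x0 x * e.1.2, x.2 + dist3 x0 x * e.2).
Proof.
have [d0|dn] := eqVneq (dist3 x0 x) 0.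
  exists e3; first exact: e3_unit.
  rewrite d0 !mul0r !addr0; move/eqP: d0; rewrite dist3_eq0 => /eqP ->.
  by case: x => -[].
have d2 : dist3 x0 x ^+ 2 = sqdist R x x0 by rewrite dist3E sqr_sqrtr// sqdist_ge0.
set d := dist3 x0 x in dn d2 *.
exists ((x0.1.1 - x.1.1) / d, (x0.1.2 - x.1.2) / d, (x0.2 - x.2) / d) => /=.
  rewrite !exprMn -!mulrDl -/(sqdist R x x0) -d2 exprVn mulfV//.
  by rewrite expf_neq0.
have E (a b : R) : b + d * ((a - b) / d) = a by rewrite mulrC divfK// addrC subrK.
by rewrite !E; case: x0 {d dn d2 E} => -[].
Qed.

(* The first branch is the limit of the second as [rho] tends to [0]. *)
Definition ballpot (G K H : R -> R) (r rho : R) : R :=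
  if rho == 0 then 2 * (2 * r * G r - 2 * K r)
  else 2 * ((H (r + rho) - H (r - rho)) / rho - K (r + rho) - K (r - rho)).

(** Since [U] has derivative [rho / U] and [H] has derivative [u G(u)], the function [H(U z) / rho]
    is a valid [V]; at [z = rho + r] and [z = rho - r], [U] equals [r + rho] and [r - rho]. For
    [rho = 0], [U] is the constant [r] and [V] is linear. *)
Lemma ge0_ball_potential (g G K H : R -> R) (x x0 : R3 R) (r : R) :
  (forall u, 0 <= u -> 0 <= g u) -> continuous g ->
  (forall u : R, is_derive u 1 G (g u)) ->
  (forall u : R, is_derive u 1 K (G u)) -> K 0 = 0 ->
  (forall u : R, is_derive u 1 H (u * G u)) ->
  dist3 x0 x < r ->
  (\int[lebT3 R]_(y in (ball3 x0 r : set T3)) (g (dist3 y x) / dist3 y x)%:E =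
   (polarconst * ballpot G K H r (dist3 x0 x))%:E)%E.
Proof.
move=> g0 cg dG dK K0 dH dr; have [e e1 x0E] := exists_direction x x0.
set rho := dist3 x0 x in dr x0E *.
have rho0 : 0 <= rho by exact: dist3_ge0.
have r0 : 0 < r by exact: le_lt_trans dr.
rewrite -(cylconstE x e e1).
have [z0|zn] := eqVneq rho 0.
  have dV (z : R) : rho - r <= z <= rho + r -> is_derive z 1 (fun z => G r * z)
      (G (Num.sqrt (r ^+ 2 - rho ^+ 2 + 2 * rho * z))).
    move=> _; apply: deriv_eq (deriv_linear _ (G r) z) _ _ => //.
    by rewrite z0 expr0n/= subr0 mulr0 mul0r addr0 sqrtr_sqr gtr0_norm.
  rewrite (@ge0_integral_ball3 R g G K _ rho r g0 cg dG dK rho0 dr dV x x0 e e1 x0E).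
  rewrite /ballpot z0 eqxx K0 add0r sub0r subr0; congr (_%:E); ring.
have rp : 0 < rho by rewrite lt_neqAle eq_sym zn.
have dV (z : R) : rho - r <= z <= rho + r ->
    is_derive z 1 (fun z => rho^-1 * H (Num.sqrt (r ^+ 2 - rho ^+ 2 + 2 * rho * z)))
      (G (Num.sqrt (r ^+ 2 - rho ^+ 2 + 2 * rho * z))).
  move=> /andP[z1 z2].
  (* As [z >= rho - r], the radicand is at least [(r - rho)^2]. *)
  have p : 0 < r ^+ 2 - rho ^+ 2 + 2 * rho * z.
    have : 0 < (r - rho) ^+ 2 by rewrite exprn_gt0// subr_gt0.
    nra.
  have sp : Num.sqrt (r ^+ 2 - rho ^+ 2 + 2 * rho * z) != 0 by rewrite gt_eqF// sqrtr_gt0.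
  have d1 : is_derive z 1 (fun z => r ^+ 2 - rho ^+ 2 + 2 * rho * z) (2 * rho).
    by apply: deriv_eq (deriv_add _ _ _ _ _ _ (deriv_cst _ _ z) (deriv_linear _ (2 * rho) z)) _ _
      => //; rewrite add0r.
  have d2 := deriv_compose _ Num.sqrt (fun z => r ^+ 2 - rho ^+ 2 + 2 * rho * z) z _ _
    (is_derive1_sqrt p) d1.
  have d3 := deriv_compose _ H (fun z => Num.sqrt (r ^+ 2 - rho ^+ 2 + 2 * rho * z)) z _ _
    (dH _) d2.
  by apply: deriv_eq (deriv_scale _ rho^-1 _ _ _ d3) _ _ => //; field; rewrite ?zn ?sp.
rewrite (@ge0_integral_ball3 R g G K _ rho r g0 cg dG dK rho0 dr dV x x0 e e1 x0E).
rewrite /ballpot (negbTE zn) K0.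
have -> : r ^+ 2 - rho ^+ 2 + 2 * rho * (rho + r) = (r + rho) ^+ 2 by ring.
have -> : r ^+ 2 - rho ^+ 2 + 2 * rho * (rho - r) = (r - rho) ^+ 2 by ring.
rewrite !sqrtr_sqr !gtr0_norm ?subr_gt0 ?addr_gt0// (addrC rho r); congr (_%:E); ring.
Qed.

End BallPotential.

(** * The sine and cosine kernels *)

Section TrigPotential.
Context (R : realType).
Local Notation mR := (measurableTypeR R).
Local Notation T3 := (mR * mR * mR)%type.
Local Notation mu := (@lebesgue_measure R).

Lemma ge0_integrable (D : set T3) (f : T3 -> R) : measurable D -> measurable_fun setT f ->
  (forall y, 0 <= f y) -> (\int[lebT3 R]_(y in D) (f y)%:E < +oo)%E ->
  (lebT3 R).-integrable D (EFin \o f).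
Proof.
move=> mD mf f0 fy; apply/integrableP; split.
  by apply: measurable_funTS; apply/measurable_EFinP.
rewrite (eq_integral (fun y => (f y)%:E))// => y _.
by rewrite /= ger0_norm.
Qed.

Lemma deriv_half_sqr (u : R) : is_derive u 1 (fun u => 2^-1 * u ^+ 2) u.
Proof.
by apply: deriv_eq (deriv_scale _ 2^-1 _ _ _ (deriv_pow _ 1 u)) _ _ => //; field.
Qed.

Lemma deriv_third_cube (u : R) : is_derive u 1 (fun u => 3^-1 * u ^+ 3) (u * u).
Proof.
by apply: deriv_eq (deriv_scale _ 3^-1 _ _ _ (deriv_pow _ 2 u)) _ _ => //; field.
Qed.

(** Both [1] and [1 + g] are nonnegative and have finite integrals; [ballpot] is linear in the
    triple [(G, K, H)], so the formulas subtract. *)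
Lemma ball_potential (g G K H : R -> R) (x x0 : R3 R) (r : R) :
  (forall u, - 1 <= g u) -> continuous g ->
  (forall u : R, is_derive u 1 G (g u)) ->
  (forall u : R, is_derive u 1 K (G u)) -> K 0 = 0 ->
  (forall u : R, is_derive u 1 H (u * G u)) ->
  dist3 x0 x < r ->
  (lebT3 R).-integrable (ball3 x0 r : set T3) (EFin \o (fun y => g (dist3 y x) / dist3 y x)) /\
  \int[lebT3 R]_(y in (ball3 x0 r : set T3)) (g (dist3 y x) / dist3 y x) =
    polarconst R * ballpot R G K H r (dist3 x0 x).
Proof.
move=> g1 cg dG dK K0 dH dr.
have mB := measurable_ball3 R x0 r.
have c1 : continuous (fun _ : R => 1 : R) by move=> ?; exact: cvg_cst.
have E1 := ge0_ball_potential R (fun=> 1) (fun u => u) (fun u => 2^-1 * u ^+ 2)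
  (fun u => 3^-1 * u ^+ 3) x x0 r (fun _ _ => ler01) c1 (deriv_id _) deriv_half_sqr.
have {}E1 := E1 (ltac:(by rewrite expr0n/= mulr0)) deriv_third_cube dr.
have c2 : continuous (fun u => 1 + g u).
  by move=> u; apply: continuousD; [exact: cvg_cst|exact: cg].
have E2 := ge0_ball_potential R (fun u => 1 + g u) (fun u => u + G u)
  (fun u => 2^-1 * u ^+ 2 + K u) (fun u => 3^-1 * u ^+ 3 + H u) x x0 r.
have {}E2 := E2 (fun u _ => ltac:(by have := g1 u; lra)) c2
  (fun u => deriv_add _ _ _ _ _ _ (deriv_id _ u) (dG u))
  (fun u => deriv_add _ _ _ _ _ _ (deriv_half_sqr u) (dK u)).
have {}E2 := E2 (ltac:(by rewrite expr0n/= mulr0 K0 addr0)).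
have {}E2 := E2 (fun u => deriv_eq _ _ _ _ _ _
  (deriv_add _ _ _ _ _ _ (deriv_third_cube u) (dH u)) (fun _ => erefl)
  (esym (mulrDr u u (G u)))) dr.
have mk1 : measurable_fun setT (fun y : T3 => 1 / dist3 y x).
  exact: (measurable_dist_kernel R (fun=> 1) x c1).
have mk2 : measurable_fun setT (fun y : T3 => (1 + g (dist3 y x)) / dist3 y x).
  exact: (measurable_dist_kernel R (fun u => 1 + g u) x c2).
have i1 : (lebT3 R).-integrable (ball3 x0 r : set T3)
    (EFin \o (fun y => 1 / dist3 y x)).
  apply: (ge0_integrable _ _ mB mk1).
  - by move=> y; rewrite divr_ge0// dist3_ge0.
  - by rewrite E1 ltry.
have i2 : (lebT3 R).-integrable (ball3 x0 r : set T3)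
    (EFin \o (fun y => (1 + g (dist3 y x)) / dist3 y x)).
  apply: (ge0_integrable _ _ mB mk2).
  - by move=> y; rewrite divr_ge0 ?dist3_ge0//; have := g1 (dist3 y x); lra.
  - by rewrite E2 ltry.
have fE : (fun y => g (dist3 y x) / dist3 y x) =
    (fun y : T3 => (1 + g (dist3 y x)) / dist3 y x - 1 / dist3 y x).
  by apply/funext => y; rewrite -mulrBl addrC addKr.
rewrite fE; split.
  exact: (integrableB mB i2 i1).
rewrite (RintegralB mB i2 i1) /Rintegral E1 E2/= -mulrBr; congr (_ * _).
rewrite /ballpot; case: ifP => [_|/negbT zn]; first by ring.
by field.
Qed.

(* Continuous at [0], where the quotient [sin (lam * 0) / 0] would be [0]. *)
Definition sinc (lam rho : R) := if rho == 0 then lam else sin (lam * rho) / rho.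

Lemma deriv_lin (a b c : R) (f g : R -> R) (u df dg : R) :
  is_derive u 1 f df -> is_derive u 1 g dg ->
  is_derive u 1 (fun u => a * (b * f u + c * g u)) (a * (b * df + c * dg)).
Proof.
move=> df' dg'; exact: (deriv_scale _ a _ _ _
  (deriv_add _ _ _ _ _ _ (deriv_scale _ b _ _ _ df') (deriv_scale _ c _ _ _ dg'))).
Qed.

(** Expanding sines and cosines of [lam (r + rho)] and [lam (r - rho)], the result factors: [r]
    enters only through [sin t - t cos t] at [t = lam r], and [rho] only through [sinc]. This is the
    mean value formula for the regular kernel. *)
Lemma ball_sin (lam r : R) (x x0 : R3 R) : 0 < lam -> dist3 x0 x < r ->
  (lebT3 R).-integrable (ball3 x0 r : set T3)
     (EFin \o (fun y => sin (lam * dist3 y x) / dist3 y x)) /\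
  \int[lebT3 R]_(y in (ball3 x0 r : set T3)) (sin (lam * dist3 y x) / dist3 y x) =
  4 * polarconst R / lam ^+ 3 * (sin (lam * r) - lam * r * cos (lam * r)) *
    sinc lam (dist3 x0 x).
Proof.
move=> l0 dr; have ln : lam != 0 by rewrite gt_eqF.
have g1 (u : R) : - 1 <= sin (lam * u) by exact: sin_geN1.
have cg : continuous (fun u : R => sin (lam * u)).
  by move=> u; apply: is_derive_continuous (deriv_sin _ lam u).
have dG (u : R) : is_derive u 1 (fun u => - lam^-1 * cos (lam * u)) (sin (lam * u)).
  by apply: deriv_eq (deriv_scale _ (- lam^-1) _ _ _ (deriv_cos _ lam u)) _ _ => //; field.
have dK (u : R) : is_derive u 1 (fun u => - lam^-1 ^+ 2 * sin (lam * u))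
    (- lam^-1 * cos (lam * u)).
  by apply: deriv_eq (deriv_scale _ (- lam^-1 ^+ 2) _ _ _ (deriv_sin _ lam u)) _ _ => //; field.
have K0 : - lam^-1 ^+ 2 * sin (lam * 0) = 0 by rewrite mulr0 sin0 mulr0.
have dH (u : R) : is_derive u 1
    (fun u => - lam^-1 ^+ 3 * (lam * (u * sin (lam * u)) + 1 * cos (lam * u)))
    (u * (- lam^-1 * cos (lam * u))).
  apply: deriv_eq (deriv_lin (- lam^-1 ^+ 3) lam 1 _ _ _ _ _
    (deriv_mul _ _ _ _ _ _ (deriv_id _ u) (deriv_sin _ lam u)) (deriv_cos _ lam u)) _ _ => //.
  by field.
have [i ->] := ball_potential _ _ _ _ x x0 r g1 cg dG dK K0 dH dr; split=> //.
rewrite /ballpot /sinc; case: ifP => [_|/negbT zn]; first by field.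
set rho := dist3 x0 x in zn *.
rewrite !mulrDr !mulrN !sinD !cosD !sinN !cosN.
by field; rewrite ln zn.
Qed.

(** The subtracted term is what the mean value formula would give for a kernel regular in the ball;
    the right-hand side is the defect due to the singularity at the inner point [x]. *)
Lemma ball_cos (lam r : R) (x x0 : R3 R) : 0 < lam -> dist3 x0 x < r -> x0 != x ->
  (lebT3 R).-integrable (ball3 x0 r : set T3)
     (EFin \o (fun y => cos (lam * dist3 y x) / dist3 y x)) /\
  \int[lebT3 R]_(y in (ball3 x0 r : set T3)) (cos (lam * dist3 y x) / dist3 y x) -
  4 * polarconst R / lam ^+ 3 * (sin (lam * r) - lam * r * cos (lam * r)) *
    (cos (lam * dist3 x0 x) / dist3 x0 x) =
  let s := lam * r - lam * dist3 x0 x in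
  4 * polarconst R / lam ^+ 3 / dist3 x0 x * (lam * r * (cos s - 1) + s - sin s).
Proof.
move=> l0 dr xx; have ln : lam != 0 by rewrite gt_eqF.
have g1 (u : R) : - 1 <= cos (lam * u) by exact: cos_geN1.
have cg : continuous (fun u : R => cos (lam * u)).
  by move=> u; apply: is_derive_continuous (deriv_cos _ lam u).
have dG (u : R) : is_derive u 1 (fun u => lam^-1 * sin (lam * u)) (cos (lam * u)).
  by apply: deriv_eq (deriv_scale _ lam^-1 _ _ _ (deriv_sin _ lam u)) _ _ => //; field.
(* The constant term makes this antiderivative vanish at 0. *)
have dK (u : R) : is_derive u 1 (fun u => lam^-1 ^+ 2 * (1 * 1 + - 1 * cos (lam * u)))
    (lam^-1 * sin (lam * u)).
  apply: deriv_eq (deriv_lin (lam^-1 ^+ 2) 1 (- 1) _ _ _ _ _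
    (deriv_cst _ 1 u) (deriv_cos _ lam u)) _ _ => //; by field.
have K0 : lam^-1 ^+ 2 * (1 * 1 + - 1 * cos (lam * 0)) = 0 by rewrite mulr0 cos0; ring.
have dH (u : R) : is_derive u 1
    (fun u => lam^-1 ^+ 3 * (- lam * (u * cos (lam * u)) + 1 * sin (lam * u)))
    (u * (lam^-1 * sin (lam * u))).
  apply: deriv_eq (deriv_lin (lam^-1 ^+ 3) (- lam) 1 _ _ _ _ _
    (deriv_mul _ _ _ _ _ _ (deriv_id _ u) (deriv_cos _ lam u)) (deriv_sin _ lam u)) _ _ => //.
  by field.
have [i ->] := ball_potential _ _ _ _ x x0 r g1 cg dG dK K0 dH dr; split=> //.
have zn : dist3 x0 x != 0 by rewrite dist3_eq0.
rewrite /ballpot (negbTE zn).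
set rho := dist3 x0 x in zn *.
rewrite !mulrDr !mulrN !sinD !cosD !sinN !cosN.
by field; rewrite ln zn.
Qed.

End TrigPotential.

(** * The Gamma and Bessel functions *)

Section GammaFun.
Context (R : realType).
Local Notation mR := (measurableTypeR R).
Local Notation mu := (@lebesgue_measure R).

Definition gamma_integrand (s t : R) : R := t `^ (s - 1) * expR (- t).

Lemma gamma_integrand_ge0 s t : 0 <= gamma_integrand s t.
Proof. by rewrite mulr_ge0 ?powR_ge0 ?expR_ge0. Qed.

(** Valued in the extended reals, so that the recursion can be proved before finiteness; the
    interval is open at 0 to be exhausted by compact intervals on which powers are smooth. *)
Definition gammaI (s : R) : \bar R :=
  (\int[mu]_(t in `]0%R, +oo[) (gamma_integrand s t)%:E)%E.

(** At [n = 0] this is the single point 1, a case treated apart wherever the fundamental theorem of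
    calculus asks for distinct end points. *)
Definition exhaust (n : nat) : set R := [set` `[n.+1%:R^-1, n.+1%:R]].

Lemma bigcup_exhaust : \bigcup_n exhaust n = [set` `]0, +oo[].
Proof.
apply/seteqP; split=> x /=.
  case=> n _; rewrite /exhaust/= !in_itv/= andbT => /andP[h _].
  by apply: lt_le_trans h; rewrite invr_gt0.
rewrite in_itv/= andbT => x0.
have m0 : 0 <= x + x^-1 by rewrite addr_ge0 ?invr_ge0 ?ltW.
exists (Num.trunc (x + x^-1)) => //; rewrite /exhaust/= in_itv/=.
have /andP[_ h] := truncn_itv m0.
have xi : 0 < x^-1 by rewrite invr_gt0.
apply/andP; split; last by lra.
rewrite -[leRHS]invrK lef_pV2 ?posrE ?ltr0Sn//; lra.
Qed.

Lemma exhaust_sub : {homo exhaust : n m / (n <= m)%N >-> (n <= m)%O}.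
Proof.
move=> n m nm; apply/subsetPset => x; rewrite /exhaust/= !in_itv/= => /andP[h1 h2].
have le : n.+1%:R <= m.+1%:R :> R by rewrite ler_nat.
apply/andP; split; last exact: le_trans le.
by apply: le_trans h1; rewrite lef_pV2 ?posrE ?ltr0Sn.
Qed.

Lemma measurable_gamma s : measurable_fun setT (gamma_integrand s).
Proof.
apply: measurable_funM; first exact: measurable_powR.
apply: continuous_measurable_fun => t.
apply: (@continuous_comp _ _ _ (fun t : R => - t) expR).
  by apply: continuousN; exact: cvg_id.
exact: continuous_expR.
Qed.

Lemma gammaI_cvg s :
  (\int[mu]_(t in exhaust n) (gamma_integrand s t)%:E @[n --> \oo] --> gammaI s)%E.
Proof.
rewrite /gammaI -bigcup_exhaust.
apply: ge0_nondecreasing_set_cvg_integral => //.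
- exact: exhaust_sub.
- by move=> n; exact: measurable_itv.
- by move=> n; apply: measurable_funTS; apply/measurable_EFinP; exact: measurable_gamma.
- by move=> n x _; rewrite lee_fin gamma_integrand_ge0.
Qed.

Lemma exhaust_gt0 n (t : R) : n.+1%:R^-1 <= t <= n.+1%:R -> 0 < t.
Proof. by move=> /andP[h _]; apply: lt_le_trans h; rewrite invr_gt0. Qed.

Lemma gamma_cont s (t : R) : 0 < t -> {for t, continuous (gamma_integrand s)}.
Proof.
move=> t0; apply: (@continuousM _ _ (fun t => t `^ (s - 1)) (fun t => expR (- t))).
  exact: (@is_derive_continuous _ _ _ _ (@is_derive1_powR _ (s - 1) t t0)).
apply: (@continuous_comp _ _ _ (fun t : R => - t) expR).
  by apply: continuousN; exact: cvg_id.
exact: continuous_expR.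
Qed.

Lemma gamma_integrable s n : mu.-integrable (exhaust n) (EFin \o gamma_integrand s).
Proof.
apply: continuous_compact_integrable; first exact: segment_compact.
by apply: within_itv_continuous => x /exhaust_gt0; exact: gamma_cont.
Qed.

(* Since [t^s e^-t] has derivative [s t^(s-1) e^-t - t^s e^-t]. *)
Lemma gamma_step s n : 1 <= s ->
  (s%:E * \int[mu]_(t in exhaust n) (gamma_integrand s t)%:E =
   \int[mu]_(t in exhaust n) (gamma_integrand (s + 1) t)%:E +
   (gamma_integrand (s + 1) n.+1%:R - gamma_integrand (s + 1) n.+1%:R^-1)%:E)%E.
Proof.
move=> s1.
have mE : measurable (exhaust n) by exact: measurable_itv.
have [->|n0] := eqVneq n 0%N.
  rewrite (_ : exhaust 0 = [set 1]); last by rewrite /exhaust invr1 set_itv1.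
  by rewrite !integral_set1 mule0 add0e invr1 subrr.
have ab : n.+1%:R^-1 < n.+1%:R :> R.
  apply: (@lt_trans _ _ 1); first by rewrite invf_lt1 ?ltr1n ?ltr0Sn// ltnS lt0n.
  by rewrite ltr1n ltnS lt0n.
pose f t := s * gamma_integrand s t - gamma_integrand (s + 1) t.
have d (t : R) : n.+1%:R^-1 <= t <= n.+1%:R -> is_derive t 1 (gamma_integrand (s + 1)) (f t).
  move=> /exhaust_gt0 t0.
  have d1 : is_derive t 1 (fun t => t `^ (s + 1 - 1)) (s * t `^ (s - 1)).
    by rewrite addrK; exact: is_derive1_powR.
  have d2 : is_derive t 1 (fun t => expR (- t)) (- expR (- t)).
    have d3 := deriv_compose _ expR (fun t : R => - t) t _ _ (is_derive_expR (- t))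
      (deriv_opp _ _ _ _ (deriv_id _ t)).
    by apply: deriv_eq d3 _ _ => //; rewrite mulrN1.
  apply: deriv_eq (deriv_mul _ _ _ _ _ _ d1 d2) _ _ => //.
  by rewrite /f /gamma_integrand addrK; ring.
have c (t : R) : n.+1%:R^-1 <= t <= n.+1%:R -> {for t, continuous f}.
  move=> /exhaust_gt0 t0; apply: continuousB; last exact: gamma_cont.
  by apply: continuousM; [exact: cvg_cst|exact: gamma_cont].
rewrite -(integral_itv_derive _ _ _ _ _ true false ab d c) -/(exhaust n).
have i0 := gamma_integrable s n; have i1 := gamma_integrable (s + 1) n.
have i2 : mu.-integrable (exhaust n) (EFin \o f).
  apply: continuous_compact_integrable; first exact: segment_compact.
  by apply: within_itv_continuous; exact: c.
rewrite -integralZl// -integralD//; apply: eq_integral => t _.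
by rewrite /= -EFinD -EFinM; congr (_%:E); rewrite /f; ring.
Qed.

Lemma powR_le_exprn (t s : R) m : 1 <= t -> s <= m%:R -> t `^ s <= t ^+ m.
Proof.
move=> t1 sm; rewrite -powR_mulrn ?(le_trans ler01)//.
exact: ler_powR.
Qed.

(** These are the boundary terms of the integration by parts. At [t = n + 1], [t^s <= t^m] and
    [e^t >= t^(m+1) / (m+1)!] bound [t^s e^-t] by [(m+1)! / t]; at [t = 1 / (n + 1)], [s >= 1] gives
    the bound [t]. *)
Lemma gamma_tail s : 1 <= s ->
  (gamma_integrand (s + 1) n.+1%:R - gamma_integrand (s + 1) n.+1%:R^-1 @[n --> \oo] --> (0 : R)).
Proof.
move=> s1; rewrite -[X in _ --> X](subrr (0 : R)).
pose m := (Num.trunc s).+1.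
have sm : s <= m%:R by have /andP[_ /ltW] := truncn_itv (le_trans ler01 s1).
apply: cvgB.
- apply: (@squeeze_cvgr _ _ _ _ (fun=> 0) (fun n => m.+1`!%:R * n.+1%:R^-1)).
  + near=> n; rewrite gamma_integrand_ge0/= /gamma_integrand addrK.
    have n1 : 1 <= n.+1%:R :> R by rewrite ler1n.
    apply: (@le_trans _ _ (n.+1%:R ^+ m * expR (- n.+1%:R))).
      by rewrite ler_wpM2r ?expR_ge0// powR_le_exprn.
    rewrite expRN ler_pdivrMr ?expR_gt0//.
    have := @expR_ge1Dxn R n.+1%:R m (ltW (ltr0Sn _ _)).
    move=> h; have {h} h : n.+1%:R ^+ m.+1 / m.+1`!%:R <= expR (n.+1%:R : R).
      by apply: le_trans h; rewrite lerDr.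
    rewrite mulrAC ler_pdivlMr ?ltr0Sn// -exprSr [leRHS]mulrC.
    by rewrite -ler_pdivrMr// ltr0n fact_gt0.
  + exact: cvg_cst.
  + rewrite -[X in _ --> X](mulr0 m.+1`!%:R); apply: cvgM; first exact: cvg_cst.
    exact: cvg_harmonic.
- apply: (@squeeze_cvgr _ _ _ _ (fun=> 0) (fun n => n.+1%:R^-1)).
  + near=> n; rewrite gamma_integrand_ge0/= /gamma_integrand addrK.
    have n1 : 0 < (n.+1%:R^-1 : R) <= 1.
      by rewrite invr_gt0 ltr0Sn invf_le1 ?ler1n ?ltr0Sn.
    apply: (@le_trans _ _ (n.+1%:R^-1 * 1)); last by rewrite mulr1.
    apply: ler_pM; [exact: powR_ge0|exact: expR_ge0|exact: ge1r_powR|].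
    by rewrite -expR0 ler_expR oppr_le0 invr_ge0.
  + exact: cvg_cst.
  + exact: cvg_harmonic.
Unshelve. all: by end_near. Qed.

(** By [gamma_step], one sequence of truncated integrals converges to both sides. *)
Lemma gammaI_rec s : 1 <= s -> (gammaI (s + 1) = s%:E * gammaI s)%E.
Proof.
move=> s1.
have c1 : (s%:E * \int[mu]_(t in exhaust n) (gamma_integrand s t)%:E @[n --> \oo]
    --> s%:E * gammaI s)%E.
  by apply: cvgeZl => //; exact: gammaI_cvg.
have c2 : (s%:E * \int[mu]_(t in exhaust n) (gamma_integrand s t)%:E @[n --> \oo]
    --> gammaI (s + 1) + 0%:E)%E.
  under eq_fun do rewrite gamma_step//.
  apply: cvgeD; [by rewrite fin_num_adde_defl| exact: gammaI_cvg|].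
  by apply: cvg_EFin; [exact: nearW|exact: gamma_tail].
rewrite -[LHS]adde0; apply/esym; exact: (cvg_unique _ c1 c2).
Qed.

(** The quadratic term of the exponential gives [t^2 <= 8 e^(t/2)]. Since [t^(3/2)] is at most [t^2]
    for [t >= 1] and at most 1 for [t < 1], the factor 9 dominates both cases. *)
Lemma gamma52_le (t : R) : 0 < t -> gamma_integrand (5 / 2) t <= 9 * expR (- (2^-1 * t)).
Proof.
move=> t0; rewrite /gamma_integrand.
have -> : - t = - (2^-1 * t) + - (2^-1 * t) by lra.
rewrite expRD mulrA ler_pM2r ?expR_gt0// expRN ler_pdivrMr ?expR_gt0//.
have e2 : t ^+ 2 <= 8 * expR (2^-1 * t).
  have th : 0 <= 2^-1 * t by rewrite mulr_ge0 ?invr_ge0// ltW.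
  have := @expR_ge1Dxn R (2^-1 * t) 1 th; rewrite exprMn -[2`!%:R]/(2 : R); move: (expR _) => e h.
  have : 0 <= t ^+ 2 by rewrite sqr_ge0.
  move: h; rewrite exprVn; lra.
have e1 : 1 <= expR (2^-1 * t).
  by rewrite -expR0 ler_expR mulr_ge0 ?invr_ge0 ?ltW.
have [t1|t1] := leP 1 t.
  have : t `^ (5 / 2 - 1) <= t ^+ 2 by apply: powR_le_exprn => //; lra.
  lra.
have : t `^ (5 / 2 - 1) <= 1.
  rewrite -[leRHS](powRr0 t); apply: ger_powR; first by rewrite t0 ltW.
  lra.
lra.
Qed.

(** The bound 18 is the integral of [9 e^(-t/2)] over the half-line. *)
Lemma gammaI52_fin : (gammaI (5 / 2) < +oo)%E.
Proof.
apply: (@le_lt_trans _ _ 18%:E); last exact: ltry.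
have /cvg_lim <- // := gammaI_cvg (5 / 2).
apply: lime_le; first by apply: cvgP; exact: gammaI_cvg.
near=> n.
have [->|n0] := eqVneq n 0%N.
  rewrite (_ : exhaust 0 = [set 1]); last by rewrite /exhaust invr1 set_itv1.
  by rewrite integral_set1 lee_fin.
have ab : n.+1%:R^-1 < n.+1%:R :> R.
  apply: (@lt_trans _ _ 1); first by rewrite invf_lt1 ?ltr1n ?ltr0Sn// ltnS lt0n.
  by rewrite ltr1n ltnS lt0n.
have d2 (t : R) : is_derive t 1 (fun t => expR (- (2^-1 * t))) (- (2^-1 * expR (- (2^-1 * t)))).
  have d3 := deriv_compose _ expR (fun t : R => - (2^-1 * t)) t _ _
    (is_derive_expR (- (2^-1 * t))) (deriv_opp _ _ _ _ (deriv_linear _ 2^-1 t)).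
  by apply: deriv_eq d3 _ _ => //; rewrite mulrN mulrC.
have d (t : R) : n.+1%:R^-1 <= t <= n.+1%:R ->
    is_derive t 1 (fun t => - 18 * expR (- (2^-1 * t))) (9 * expR (- (2^-1 * t))).
  by move=> _; apply: deriv_eq (deriv_scale _ (- 18) _ _ _ (d2 t)) _ _ => //; field.
have c (t : R) : n.+1%:R^-1 <= t <= n.+1%:R ->
    {for t, continuous (fun t : R => 9 * expR (- (2^-1 * t)))}.
  by move=> _; exact: is_derive_continuous (deriv_scale _ 9 _ _ _ (d2 t)).
apply: (@le_trans _ _ (\int[mu]_(t in exhaust n) (9 * expR (- (2^-1 * t)))%:E)%E).
  apply: ge0_le_integral => //.
  - exact: measurable_itv.
  - by move=> t _; rewrite lee_fin gamma_integrand_ge0.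
  - by apply: measurable_funTS; apply/measurable_EFinP; exact: measurable_gamma.
  - apply: measurable_funTS; apply/measurable_EFinP; apply: continuous_measurable_fun => t.
    exact: is_derive_continuous (deriv_scale _ 9 _ _ _ (d2 t)).
  - by move=> t; rewrite /exhaust/= in_itv/= => /exhaust_gt0 t0; rewrite lee_fin gamma52_le.
rewrite (integral_itv_derive _ _ _ _ _ true false ab d c) lee_fin.
have : 0 < expR (- (2^-1 * n.+1%:R)) :> R by exact: expR_gt0.
have : expR (- (2^-1 * n.+1%:R^-1)) <= 1 :> R.
  by rewrite -expR0 ler_expR oppr_le0 mulr_ge0 ?invr_ge0.
by move: (expR _) (expR _) => a b; lra.
Unshelve. all: by end_near. Qed.

(** On [[1, 2]] the integrand is at least [e^-2]. *)
Lemma gammaI52_gt0 : (0 < gammaI (5 / 2))%E.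
Proof.
apply: (@lt_le_trans _ _ (\int[mu]_(t in `[1%R, 2%R]) (expR (- 2))%:E)%E).
  rewrite integral_cst//= lebesgue_measure_itv/= lte_fin ltr1n/= -EFinD -EFinM lte_fin.
  by rewrite mulr_gt0 ?expR_gt0//; lra.
apply: (@le_trans _ _ (\int[mu]_(t in `[1%R, 2%R]) (gamma_integrand (5 / 2) t)%:E)%E).
  apply: ge0_le_integral => //.
  - by apply: measurable_funTS; apply/measurable_EFinP; exact: measurable_gamma.
  - move=> t; rewrite /= in_itv/= => /andP[t1 t2]; rewrite lee_fin.
    rewrite -[leLHS]mul1r; apply: ler_pM; rewrite ?expR_ge0//.
      rewrite -[leLHS](powRr0 t); apply: ler_powR => //; lra.
    by rewrite ler_expR lerN2.
apply: ge0_subset_integral => //.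
- by apply: measurable_funTS; apply/measurable_EFinP; exact: measurable_gamma.
- by move=> t _; rewrite lee_fin gamma_integrand_ge0.
- by move=> t; rewrite /= !in_itv/= andbT => /andP[t1 _]; exact: lt_le_trans t1.
Qed.

Lemma GammaE s : Gamma s = fine (gammaI s).
Proof.
rewrite /Gamma /Rintegral /gammaI; congr fine.
rewrite -integral_itv_obnd_cbnd//.
by apply: measurable_funTS; apply/measurable_EFinP; exact: measurable_gamma.
Qed.

Lemma Gamma52_gt0 : 0 < Gamma (5 / 2 : R).
Proof. by rewrite GammaE fine_gt0// gammaI52_gt0 gammaI52_fin. Qed.

Lemma gammaI_fin k : gammaI (5 / 2 + k%:R) \is a fin_num.
Proof.
elim: k => [|k IH].
  by rewrite addr0 ge0_fin_numE ?gammaI52_fin// ltW// gammaI52_gt0.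
rewrite -[k.+1%:R]natr1 addrA gammaI_rec ?fin_numM//.
have : 0 <= k%:R :> R by [].
lra.
Qed.

Lemma Gamma_rec k : Gamma (5 / 2 + k.+1%:R : R) = (5 / 2 + k%:R) * Gamma (5 / 2 + k%:R).
Proof.
rewrite !GammaE -[k.+1%:R]natr1 addrA gammaI_rec; first by rewrite fineM// gammaI_fin.
have : 0 <= k%:R :> R by [].
lra.
Qed.

End GammaFun.

(** * The Bessel function of order 3/2 in closed form *)

Section Bessel.
Context (R : realType).

(** Up to a positive factor on [t > 0], this is [J_{3/2}]: see [besselJ32]. *)
Definition sinmtcos (t : R) : R := sin t - t * cos t.

(** The Pochhammer symbol of 5/2, that is, [Gamma(5/2 + k) / Gamma(5/2)]. *)
Definition rising52 (k : nat) : R := \prod_(i < k) (5 / 2 + i%:R).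

Lemma rising52_gt0 k : 0 < rising52 k.
Proof. by apply: prodr_gt0 => i _; rewrite ltr_pwDl. Qed.

Lemma Gamma_rising52 k : Gamma (k%:R + 3 / 2 + 1 : R) = Gamma (5 / 2) * rising52 k.
Proof.
have -> : k%:R + 3 / 2 + 1 = 5 / 2 + k%:R :> R by lra.
elim: k => [|k IH]; first by rewrite addr0 /rising52 big_ord0 mulr1.
by rewrite Gamma_rec IH /rising52 big_ord_recr/=; ring.
Qed.

(** Splitting [(2k+3)!] by parity: the even factors give [2^k k! (2k+2)], the odd ones [3 * 2^k]
    times the Pochhammer symbol. *)
Lemma fact_rising52 k : ((k.*2.+3)`!%:R : R) = k.*2.+2%:R * 3 * 4 ^+ k * k`!%:R * rising52 k.
Proof.
elim: k => [|k IH]; first by rewrite /rising52 big_ord0 expr0 fact0 !mulr1 -natrM.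
have c n : (k.*2 + n)%:R = 2 * k%:R + n%:R :> R by rewrite natrD -mul2n natrM.
have -> : (k.+1.*2.+3)`! = ((k.*2 + 5) * ((k.*2 + 4) * (k.*2.+3)`!))%N.
  by rewrite doubleS (_ : k.*2 + 5 = k.*2.+4.+1)%N ?addn4 ?factS// !addnS addn0.
have -> : k.+1.*2.+2 = (k.*2 + 4)%N by rewrite doubleS addn4.
rewrite 2!(natrM _ (_ + _)) IH !c /rising52 big_ord_recr/= -/(rising52 k) exprS.
have -> : k.+1`!%:R = (k%:R + 1) * k`!%:R :> R by rewrite factS natrM natr1.
have -> : k.*2.+2%:R = 2 * k%:R + 2 :> R by rewrite -addn2 c.
by field.
Qed.

(** The coefficient of [t^(2k+3)] in [sin t - t cos t] is [(-1)^k (2k+2) / (2k+3)!], which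
    [fact_rising52] turns into a term of the Bessel series. *)
Lemma cvg_series32 (t : R) : 0 < t ->
  series (fun k => (-1) ^+ k * (t / 2) ^+ k.*2 / (k`!%:R * rising52 k)) @ \oo -->
  3 * sinmtcos t / t ^+ 3.
Proof.
move=> t0; have tn : t != 0 by rewrite gt_eqF.
pose w k := sin_coeff' t k - t * cos_coeff' t k.
have cw : series w @ \oo --> sinmtcos t.
  have -> : series w = (fun n => series (sin_coeff' t) n - t * series (cos_coeff' t) n).
    by apply/funext => n; rewrite /series/= /w sumrB mulr_sumr.
  apply: cvgB; first exact: cvg_sin_coeff'.
  by apply: cvgM; [exact: cvg_cst|exact: cvg_cos_coeff'].
have E n : series (fun k => (-1) ^+ k * (t / 2) ^+ k.*2 / (k`!%:R * rising52 k)) n =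
    3 / t ^+ 3 * series w n.+1.
  (* The terms of degree 1 in [sin t] and [t cos t] cancel, whence the index shift by one. *)
  rewrite /series/= big_nat_recl//= [w 0%N](_ : _ = 0) ?add0r; last first.
    by rewrite /w /sin_coeff' /cos_coeff' double0 expr0z expr0 expr1 fact0 -[1`!]/1%N; field.
  rewrite mulr_sumr; apply: eq_bigr => k _.
  have kf : k`!%:R != 0 :> R by rewrite pnatr_eq0 -lt0n fact_gt0.
  have rn : rising52 k != 0 by rewrite gt_eqF// rising52_gt0.
  have f3 := fact_rising52 k.
  have f2 : (k.*2.+3)`!%:R = k.*2.+3%:R * (k.*2.+2)`!%:R :> R by rewrite factS natrM.
  rewrite /w /sin_coeff' /cos_coeff' doubleS.
  have k2 : k.*2.+2%:R != 0 :> R by rewrite pnatr_eq0.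
  have k3 : k.*2.+3%:R != 0 :> R by rewrite pnatr_eq0.
  have -> : (k.*2.+2)`!%:R = k.*2.+2%:R * 3 * 4 ^+ k * k`!%:R * rising52 k / k.*2.+3%:R :> R.
    by rewrite -f3 f2; field.
  have p4 : 4 ^+ k != 0 :> R by rewrite expf_neq0// pnatr_eq0.
  rewrite f3 exprSz -exprnP -[k.*2.+3]addn3 -[k.*2.+2]addn2 in k2 k3 *.
  rewrite exprMn exprVn -[in X in (t ^+ _ / X)]mul2n exprM (_ : 2 ^+ 2 = 4 :> R); last by ring.
  rewrite (natrD _ _ 3) (natrD _ _ 2) !exprD in k2 k3 *.
  by field; rewrite k3 rn kf p4 k2 tn.
rewrite (_ : series _ = (fun n => 3 / t ^+ 3 * series w n.+1)); last exact/funext.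
rewrite (_ : 3 * sinmtcos t / t ^+ 3 = 3 / t ^+ 3 * sinmtcos t); last by ring.
apply: cvgM; first exact: cvg_cst.
by move: cw; rewrite -cvg_shiftS.
Qed.

Lemma besselJ32 (t : R) : 0 < t ->
  besselJ (3 / 2) t = (t / 2) `^ (3 / 2) / Gamma (5 / 2) * (3 * sinmtcos t / t ^+ 3).
Proof.
move=> t0; have th : 0 < t / 2 by rewrite divr_gt0.
have G0 : Gamma (5 / 2 : R) != 0 by rewrite gt_eqF// Gamma52_gt0.
rewrite /besselJ; apply/cvg_lim => //.
set u := fun k => _.
rewrite (_ : series u = fun n => (t / 2) `^ (3 / 2) / Gamma (5 / 2) *
  series (fun k => (-1) ^+ k * (t / 2) ^+ k.*2 / (k`!%:R * rising52 k)) n); last first.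
  apply/funext => n; rewrite /series/= mulr_sumr; apply: eq_bigr => k _; rewrite /u.
  rewrite Gamma_rising52 powRD; last by rewrite gt_eqF//= implybT.
  have -> : 2 * k%:R = k.*2%:R :> R by rewrite -mul2n natrM.
  rewrite powR_mulrn ?ltW//.
  have kf : k`!%:R != 0 :> R by rewrite pnatr_eq0 -lt0n fact_gt0.
  have rn : rising52 k != 0 by rewrite gt_eqF// rising52_gt0.
  by move: (_ `^ _) ((t / 2) ^+ _) => a b; field; rewrite G0 rn kf.
by apply: cvgM; [exact: cvg_cst|exact: cvg_series32].
Qed.

Lemma a3mE (t : R) : 0 < t -> a3m t = 3 * sinmtcos t / t ^+ 3.
Proof.
move=> t0; have th : 0 < t / 2 by rewrite divr_gt0.
have G0 : Gamma (5 / 2 : R) != 0 by rewrite gt_eqF// Gamma52_gt0.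
have p0 : (t / 2) `^ (3 / 2) != 0 by rewrite gt_eqF// powR_gt0.
rewrite /a3m besselJ32//; move: (_ `^ _) p0 (_ / t ^+ 3) => a p0 b.
by field; rewrite ?G0 ?p0.
Qed.

Lemma deriv_sinmtcos (t : R) : is_derive t 1 sinmtcos (t * sin t).
Proof.
have d1 := deriv_mul _ _ _ _ _ _ (deriv_id _ t) (is_derive_cos t).
apply: deriv_eq (deriv_add _ _ _ _ _ _ (is_derive_sin t) (deriv_opp _ _ _ _ d1)) _ _ => //.
by ring.
Qed.

Lemma continuous_sinmtcos : continuous sinmtcos.
Proof. by move=> t; exact: is_derive_continuous (deriv_sinmtcos t). Qed.

(** The function vanishes at 0 and has derivative [t sin t], positive on []0, 2[]. *)
Lemma sinmtcos_small (a : R) : 0 < a < 2 -> 0 < sinmtcos a.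
Proof.
move=> /andP[a0 a2].
have [] := @MVT R sinmtcos (fun t => t * sin t) 0 a a0.
- by move=> x _; exact: deriv_sinmtcos.
- by apply: continuous_subspaceT => x; exact: continuous_sinmtcos.
move=> c; rewrite in_itv/= => /andP[c0 ca].
rewrite /sinmtcos sin0 mul0r !subr0 => ->.
by rewrite !mulr_gt0// sin2_gt0// c0 (lt_trans ca).
Qed.

(** There is no zero before [j], and the function is positive near 0; a negative value at some
    [t >= 2] would give a zero between 1 and [t] by the intermediate value theorem. *)
Lemma sinmtcos_gt0 (j t : R) : first_pos_zero_J32 j -> 0 < t < j -> 0 < sinmtcos t.
Proof.
move=> [j0 [_ jn]] /andP[t0 tj].
have nz (s : R) : 0 < s <= t -> sinmtcos s != 0.
  move=> /andP[s0 st]; have := jn s; rewrite s0 (le_lt_trans st tj) => /(_ isT).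
  by rewrite besselJ32// => /negP h; apply/negP => /eqP z; apply: h; rewrite z mulr0 mul0r mulr0.
rewrite lt_neqAle eq_sym nz ?t0 ?lexx//= leNgt; apply/negP => tneg.
have [t2|t2] := ltP t 2.
  by have := sinmtcos_small t; rewrite t0 t2 => /(_ isT); lra.
have s1 : 0 < sinmtcos 1 by apply: sinmtcos_small; lra.
have [] := @IVT R sinmtcos 1 t 0.
- lra.
- by apply: continuous_subspaceT => x; exact: continuous_sinmtcos.
- by rewrite ge_min le_max (ltW tneg) (ltW s1) orbT.
move=> c; rewrite in_itv/= => /andP[c1 ct] /eqP; apply/negP/nz.
by rewrite ct andbT; lra.
Qed.

End Bessel.

(** * Comparison of the domain with the ball *)

Section OpenSets.
Context (R : realType).
Local Notation mR := (measurableTypeR R).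
Local Notation T3 := (mR * mR * mR)%type.

(** A ball of the product topology, in which [open] is understood; [ball3_cube] links it to the
    Euclidean balls. *)
Definition cube (y : R3 R) (s : R) : set T3 :=
  [set z | [/\ `|z.1.1 - y.1.1| < s, `|z.1.2 - y.1.2| < s & `|z.2 - y.2| < s]].

Lemma measurable_cube y s : measurable (cube y s).
Proof.
have -> : cube y s = [set` `]y.1.1 - s, y.1.1 + s[] `*` [set` `]y.1.2 - s, y.1.2 + s[] `*`
    [set` `]y.2 - s, y.2 + s[].
  apply/seteqP; split=> z; rewrite /cube/= !in_itv/= !ltr_distl.
    by case=> -> -> ->.
  by case=> -[-> ->] ->.
by apply: measurableX => //; apply: measurableX.
Qed.

Lemma open_cube (D : set (R3 R)) y : open D -> D y -> exists2 s, 0 < s & cube y s `<=` D.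
Proof.
move=> oD Dy; have /nbhs_ballP[s /= s0 sD] : nbhs y D by exact: open_nbhs_nbhs.
exists s => // z [h1 h2 h3]; apply: sD.
by split; [split|]; rewrite /ball/= distrC.
Qed.

Lemma ball3_cube (y : R3 R) s : ball3 y s `<=` cube y s.
Proof.
move=> z; rewrite /ball3/= dist3E /sqdist => h.
have le (a b : R) : 0 <= b -> Num.sqrt (a ^+ 2 + b) < s -> `|a| < s.
  by move=> b0; apply: le_lt_trans; rewrite -sqrtr_sqr ler_wsqrtr// lerDl.
split.
- by apply: (le _ ((z.1.2 - y.1.2) ^+ 2 + (z.2 - y.2) ^+ 2));
    rewrite ?addrA// addr_ge0 ?sqr_ge0.
- by apply: (le _ ((z.1.1 - y.1.1) ^+ 2 + (z.2 - y.2) ^+ 2));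
    rewrite ?addr_ge0 ?sqr_ge0// addrA (addrC (_ ^+ 2)).
- by apply: (le _ ((z.1.1 - y.1.1) ^+ 2 + (z.1.2 - y.1.2) ^+ 2));
    rewrite ?addr_ge0 ?sqr_ge0// addrC.
Qed.

Lemma open_ball3 (D : set (R3 R)) y : open D -> D y -> exists2 s, 0 < s & ball3 y s `<=` D.
Proof.
move=> oD Dy; have [s s0 sD] := open_cube D y oD Dy; exists s => //.
by apply: subset_trans sD; exact: ball3_cube.
Qed.

(** An open set is the countable union of the cubes it contains that have a rational centre and a
    radius [1 / (n + 1)]. *)
Lemma measurable_open3 (D : set T3) : open (D : set (R3 R)) -> measurable D.
Proof.
move=> oD.
pose P (i : rat * rat * rat * nat) : set T3 :=
  cube (ratr i.1.1.1, ratr i.1.1.2, ratr i.1.2) i.2.+1%:R^-1.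
pose Q n : set T3 := if unpickle n is Some i then
  if `[< P i `<=` D >] then P i else set0 else set0.
have -> : D = \bigcup_n Q n.
  apply/seteqP; split=> [y Dy|y [n _]]; last first.
    by rewrite /Q; case: unpickle => // i; case: asboolP => // h /h.
  have [s s0 sD] := open_cube D y oD Dy.
  (* The radius [d] falls below [s / 2], so a cube of radius [d] that contains [y] lies in the cube
     of radius [s] about [y]. *)
  pose n := Num.trunc (2 / s); pose d : R := n.+1%:R^-1.
  have d0 : 0 < d by rewrite invr_gt0.
  have ds : d < s / 2.
    rewrite /d -[ltRHS]invrK ltf_pV2 ?posrE ?invr_gt0 ?divr_gt0// invf_div.
    by have /andP[] := truncn_itv (ltW (divr_gt0 (ltr0Sn R 1) s0)).
  have rr (a : R) : exists q : rat, `|a - ratr q| < d.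
    have [q] := @rat_in_itvoo R (a - d) (a + d) ltac:(lra).
    by rewrite in_itv/= => h; exists q; rewrite distrC ltr_distl.
  have [q1 h1] := rr y.1.1; have [q2 h2] := rr y.1.2; have [q3 h3] := rr y.2.
  exists (pickle (q1, q2, q3, n)); first exact: I.
  rewrite /Q pickleK.
  case: asboolP => [_|]; first by split.
  case=> z [k1 k2 k3]; apply: sD.
  have tri (a b c : R) : `|c - b| < d -> `|a - b| < d -> `|c - a| < s.
    rewrite !ltr_distl => /andP[? ?] /andP[? ?]; apply/andP; split; lra.
  by split; [exact: tri k1 h1|exact: tri k2 h2|exact: tri k3 h3].
apply: bigcup_measurable => n _; rewrite /Q; case: unpickle => // i.
by case: ifP => // _; exact: measurable_cube.
Qed.

Lemma ball3_gt0 (y : R3 R) s : 0 < s -> (0 < lebT3 R (ball3 y s))%E.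
Proof.
move=> s0; rewrite lebT3_ball3// lte_fin !mulr_gt0 ?exprn_gt0//.
exact: polarconst_gt0.
Qed.

Lemma null_open3 (D : set T3) : open (D : set (R3 R)) -> lebT3 R D = 0%E -> D = set0.
Proof.
move=> oD D0; apply/seteqP; split=> // y Dy; have [s s0 sD] := open_ball3 D y oD Dy.
have := ball3_gt0 y s s0; rewrite ltNge => /negP; apply; rewrite -D0.
by apply: le_measure; rewrite ?inE//; [exact: measurable_ball3|exact: measurable_open3].
Qed.

End OpenSets.

(** * Exchange of integrals, and vanishing integrals *)

Section Swap.
Context (R : realType).
Local Notation mR := (measurableTypeR R).
Local Notation T3 := (mR * mR * mR)%type.

Lemma bounded_integrable (D : set T3) (f : T3 -> R) (M : R) : measurable D ->
  (lebT3 R D < +oo)%E -> measurable_fun setT f -> (forall y, `|f y| <= M) ->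
  (lebT3 R).-integrable D (EFin \o f).
Proof.
move=> mD Dfin mf fM; apply: measurable_bounded_integrable => //.
  exact: measurable_funTS.
exists M; split; first exact: num_real.
by move=> x Mx y _; exact: le_trans (fM y) (ltW Mx).
Qed.

(** A bounded kernel is integrable on a product of sets of finite measure; Fubini's theorem is
    applied to its extension by zero. *)
Lemma Rintegral_swap (S D : set T3) (F : T3 * T3 -> R) (M : R) :
  measurable S -> measurable D -> (lebT3 R S < +oo)%E -> (lebT3 R D < +oo)%E ->
  measurable_fun setT F -> (forall z, `|F z| <= M) ->
  \int[lebT3 R]_(x in S) (\int[lebT3 R]_(y in D) F (x, y)) =
  \int[lebT3 R]_(y in D) (\int[lebT3 R]_(x in S) F (x, y)).
Proof.
move=> mS mD Sf Df mF FM.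
have mSD : measurable (S `*` D) by exact: measurableX.
have i : (lebT3 R \x lebT3 R)%E.-integrable (S `*` D) (EFin \o F).
  have pE : (lebT3 R \x lebT3 R)%E (S `*` D) = (lebT3 R S * lebT3 R D)%E.
    exact: product_measure1E.
  apply: measurable_bounded_integrable => //.
  - apply: (@le_lt_trans _ _ (lebT3 R S * lebT3 R D)%E); first by rewrite -pE.
    by apply: lte_mul_pinfty => //; rewrite ge0_fin_numE.
  - exact: measurable_funTS.
  exists M; split; first exact: num_real.
  by move=> x Mx y _; exact: le_trans (FM y) (ltW Mx).
have i' := (integrable_mkcond (EFin \o F) mSD).1 i.
have sx x : measurable_fun setT (fun y => F (x, y)).
  by apply: (measurableT_comp mF); exact: pair1_measurable.
have sy y : measurable_fun setT (fun x => F (x, y)).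
  by apply: (measurableT_comp mF); exact: pair2_measurable.
have E1 x : (\int[lebT3 R]_(y in D) (F (x, y))%:E)%E =
    (\int[lebT3 R]_(y in D) F (x, y))%:E.
  rewrite /Rintegral fineK//; apply: integrable_fin_num => //.
  exact: (bounded_integrable D (fun y => F (x, y)) M).
have E2 y : (\int[lebT3 R]_(x in S) (F (x, y))%:E)%E =
    (\int[lebT3 R]_(x in S) F (x, y))%:E.
  rewrite /Rintegral fineK//; apply: integrable_fin_num => //.
  exact: (bounded_integrable S (fun x => F (x, y)) M).
rewrite [LHS]/Rintegral [RHS]/Rintegral; congr fine.
under eq_integral do rewrite -E1.
under [RHS]eq_integral do rewrite -E2.
have := Fubini i'.
set L := (X in X = _ -> _); set L' := (X in _ = X -> _) => LL.
have -> : (\int[lebT3 R]_(x in S) \int[lebT3 R]_(y in D) (F (x, y))%:E = L)%E.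
  rewrite integral_mkcond; apply: eq_integral => x _; rewrite patchE.
  case: ifPn => xS.
    rewrite integral_mkcond; apply: eq_integral => y _; rewrite !patchE.
    congr (if _ then _ else _); apply/idP/idP; rewrite !inE/=; last by case.
    by move: xS; rewrite inE.
  rewrite integral0_eq// => y _; rewrite patchE ifN//.
  by apply: contra xS; rewrite !inE => -[].
rewrite LL; symmetry; rewrite integral_mkcond; apply: eq_integral => y _; rewrite patchE.
case: ifPn => yD.
  rewrite integral_mkcond; apply: eq_integral => x _; rewrite !patchE.
  congr (if _ then _ else _); apply/idP/idP; rewrite !inE/=; last by case.
  by move: yD; rewrite inE.
rewrite integral0_eq// => x _; rewrite patchE ifN//.
by apply: contra yD; rewrite !inE => -[].
Qed.

Lemma pos_integral_null (A : set T3) (f : T3 -> R) : measurable A ->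
  measurable_fun setT f -> (forall y, A y -> 0 <= f y) ->
  (lebT3 R).-integrable A (EFin \o f) ->
  \int[lebT3 R]_(y in A) f y = 0 -> lebT3 R (A `&` [set y | f y != 0]) = 0%E.
Proof.
move=> mA mf f0 i I0.
have mE : measurable (A `&` [set y | f y != 0]).
  apply: measurableI => //.
  have -> : [set y | f y != 0] = f @^-1` (~` [set 0]).
    by apply/seteqP; split=> y /=; move/eqP.
  by rewrite -[X in measurable X]setTI; apply: mf => //; exact: measurableC.
have : (\int[lebT3 R]_(y in A) `|(EFin \o f) y| = 0)%E.
  transitivity (\int[lebT3 R]_(y in A) (f y)%:E)%E.
    by apply: eq_integral => y; rewrite inE => Ay /=; rewrite ger0_norm// f0.
  move: I0; rewrite /Rintegral => I0.
  by rewrite -[LHS]fineK ?I0//; exact: integrable_fin_num.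
move/ae_eq_integral_abs; case=> //.
  by apply: measurable_funTS; apply/measurable_EFinP.
move=> N [mN N0 sN]; apply/eqP; rewrite eq_le measure_ge0 andbT -N0.
apply: le_measure; rewrite ?inE// => y [Ay fy]; apply: sN => /= /(_ Ay) [] /eqP.
by rewrite (negbTE fy).
Qed.

End Swap.

(** * Mean values over a shell around the domain *)

Section MeanValue.
Context (R : realType).
Local Notation mR := (measurableTypeR R).
Local Notation T3 := (mR * mR * mR)%type.

Lemma norm_sin_le (v : R) : 0 <= v -> `|sin v| <= v.
Proof.
rewrite le_eqVlt => /predU1P[<-|v0]; first by rewrite sin0 normr0.
have [] := @MVT R sin cos 0 v v0.
  by apply: continuous_subspaceT => x; exact: continuous_sin.
move=> c _; rewrite sin0 !subr0 => ->.
by rewrite normrM (gtr0_norm v0) ler_piMl ?cos_max// ltW.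
Qed.

Lemma norm_sin_div_le (lam d : R) : 0 < lam -> 0 <= d -> `|sin (lam * d) / d| <= lam.
Proof.
move=> l0; rewrite le_eqVlt => /predU1P[<-|d0]; first by rewrite invr0 mulr0 normr0 ltW.
rewrite normrM normfV (gtr0_norm d0) ler_pdivrMr//.
by apply: norm_sin_le; rewrite mulr_ge0 ?ltW.
Qed.

Lemma norm_sinc_le (lam d : R) : 0 < lam -> 0 <= d -> `|sinc R lam d| <= lam.
Proof.
move=> l0 d0; rewrite /sinc; case: ifP => _; first by rewrite gtr0_norm.
exact: norm_sin_div_le.
Qed.

Lemma continuous_sin_scale (lam : R) : continuous (fun u : R => sin (lam * u)).
Proof. by move=> u; exact: is_derive_continuous (deriv_sin _ lam u). Qed.

Lemma measurable_sinc (lam : R) (x0 : R3 R) :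
  measurable_fun setT (fun y : T3 => sinc R lam (dist3 x0 y)).
Proof.
(* The two functions differ only at [x0], where the quotient is 0 by convention and [sinc] is
   [lam]. *)
have -> : (fun y : T3 => sinc R lam (dist3 x0 y)) = (fun y =>
    lam * \1_([set x0] : set T3) y + sin (lam * dist3 y x0) / dist3 y x0).
  apply/funext => y; rewrite /sinc dist3_eq0 eq_sym indicE dist3C.
  case: eqVneq => [->|yx].
    rewrite mem_set// mulr1.
    by have /eqP -> : dist3 x0 x0 == 0; [rewrite dist3_eq0|rewrite invr0 mulr0 addr0].
  by rewrite memNset ?mulr0 ?add0r// => /eqP; rewrite (negbTE yx).
apply: measurable_funD.
  apply: measurable_funM => //; apply: measurable_indic; exact: measurable_set1_T3.
exact: (measurable_dist_kernel R (fun u => sin (lam * u)) x0 (continuous_sin_scale lam)).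
Qed.

Lemma measurable_kernel2 (lam : R) :
  measurable_fun setT (fun z : T3 * T3 => sin (lam * dist3 z.2 z.1) / dist3 z.2 z.1).
Proof.
have [m1 m2 m3] := measurable_coord R.
have f := @measurable_fst _ _ T3 T3; have s := @measurable_snd _ _ T3 T3.
apply: (measurable_radial R _ _ (fun u => sin (lam * u))
  (fun z : T3 * T3 => (z.2.1.1 - z.1.1.1) ^+ 2 + (z.2.1.2 - z.1.1.2) ^+ 2 +
     (z.2.2 - z.1.2) ^+ 2)); first exact: continuous_sin_scale.
apply: measurable_funD; [apply: measurable_funD|];
  apply: measurable_funX; apply: measurable_funB.
- exact: (measurableT_comp m1 s).
- exact: (measurableT_comp m1 f).
- exact: (measurableT_comp m2 s).
- exact: (measurableT_comp m2 f).
- exact: (measurableT_comp m3 s).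
- exact: (measurableT_comp m3 f).
Qed.

Lemma Rintegral_setD (A B : set T3) (f : T3 -> R) : measurable A -> measurable B ->
  B `<=` A -> (lebT3 R).-integrable A (EFin \o f) ->
  \int[lebT3 R]_(y in A `\` B) f y =
  \int[lebT3 R]_(y in A) f y - \int[lebT3 R]_(y in B) f y.
Proof.
move=> mA mB BA i.
have e : A = (A `\` B) `|` B.
  by apply/seteqP; split=> y; [have [By|By] := pselect (B y) => Ay; [right|left]|case=> [[]|/BA]].
rewrite [in X in _ = X - _]e Rintegral_setU//; last 2 first.
- by rewrite -e.
- by apply/disj_setPS => y [[]].
- by rewrite addrK.
- exact: measurableD.
Qed.

Lemma ball3_sub (x0 : R3 R) (r r' : R) : r <= r' -> ball3 x0 r `<=` ball3 x0 r'.
Proof. by move=> rr y; rewrite /ball3/= => h; exact: lt_le_trans rr. Qed.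

Lemma ball3_fin (x0 : R3 R) (r : R) : 0 < r -> (lebT3 R (ball3 x0 r) < +oo)%E.
Proof. by move=> r0; rewrite lebT3_ball3// ltry. Qed.

(** The function [M] of the overview with the powers of the radius cancelled: see [ballmassE]. *)
Definition ballmass (lam r : R) : R :=
  4 * polarconst R / lam ^+ 3 * sinmtcos R (lam * r).

Lemma shell_sin (lam r r' : R) (x x0 : R3 R) : 0 < lam -> dist3 x0 x < r -> r <= r' ->
  \int[lebT3 R]_(y in ball3 x0 r' `\` ball3 x0 r) (sin (lam * dist3 y x) / dist3 y x) =
  (ballmass lam r' - ballmass lam r) * sinc R lam (dist3 x0 x).
Proof.
move=> l0 dr rr.
have [i' E'] := ball_sin R lam r' x x0 l0 (lt_le_trans dr rr).
have [i E] := ball_sin R lam r x x0 l0 dr.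
rewrite Rintegral_setD//; try exact: measurable_ball3; last exact: ball3_sub.
by rewrite [X in X - _ = _]E' [X in _ - X = _]E /ballmass /sinmtcos mulrBl.
Qed.

Lemma mean_value_center (lam r0 c : R) (D : set T3) (x0 : R3 R) :
  0 < lam -> 0 < r0 -> measurable D -> D `<=` ball3 x0 r0 ->
  (forall x, ~ D x -> \int[lebT3 R]_(y in D) (sin (lam * dist3 y x) / dist3 y x) =
     c * (sin (lam * dist3 x x0) / dist3 x x0)) ->
  \int[lebT3 R]_(y in D) sinc R lam (dist3 x0 y) = c * lam.
Proof.
move=> l0 r00 mD DB H; have ln : lam != 0 by rewrite gt_eqF.
have pi0 := @pi_gt0 R.
(* With [t1 = 2 pi n] and [t2 = t1 + pi], [sinmtcos] takes the values [- t1] and [t2], whose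
   difference [t1 + t2] is positive. Since [n > lam r0], both radii exceed [r0]. *)
pose n := (Num.trunc (lam * r0)).+1.
pose t1 : R := 0 + pi *+ 2 *+ n; pose t2 := t1 + pi.
have t1n : t1 = n%:R * (pi * 2) by rewrite /t1 add0r -(mulr_natl (pi *+ 2) n) -(mulr_natr pi).
have ln' : lam * r0 < n%:R.
  by have /andP[] := truncn_itv (ltW (mulr_gt0 l0 r00)).
have t1r : lam * r0 < t1.
  apply: (lt_le_trans ln'); rewrite t1n ler_peMr//.
  by have := @pi_ge2 R; lra.
have s1 : sin t1 = 0 by rewrite /t1 (periodicn (@sinD2pi R)) sin0.
have c1 : cos t1 = 1 by rewrite /t1 (periodicn (@cosD2pi R)) cos0.
have s2 : sin t2 = 0 by rewrite /t2 sinDpi s1 oppr0.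
have c2 : cos t2 = - 1 by rewrite /t2 cosDpi c1.
pose R1 := t1 / lam; pose R2 := t2 / lam.
have R01 : r0 < R1 by rewrite /R1 ltr_pdivlMr// mulrC.
have R12 : R1 <= R2 by rewrite /R1 /R2 ler_pM2r ?invr_gt0// /t2 lerDl ltW.
have R1p : 0 < R1 by exact: lt_trans R01.
have R2p : 0 < R2 by exact: lt_le_trans R12.
pose S : set T3 := ball3 x0 R2 `\` ball3 x0 R1.
have mS : measurable S by apply: measurableD; exact: measurable_ball3.
have Sf : (lebT3 R S < +oo)%E.
  apply: le_lt_trans (ball3_fin x0 R2 R2p); apply: le_measure; rewrite ?inE//.
    exact: measurable_ball3.
  exact: subDsetl.
have Df : (lebT3 R D < +oo)%E.
  apply: le_lt_trans (ball3_fin x0 r0 r00); apply: le_measure; rewrite ?inE//.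
  exact: measurable_ball3.
have SD x : S x -> ~ D x.
  by move=> [_ nB] /DB xB; apply: nB; apply: ball3_sub xB; exact: ltW.
have := Rintegral_swap R S D _ lam mS mD Sf Df (measurable_kernel2 lam)
  (fun z => norm_sin_div_le lam (dist3 z.2 z.1) l0 (dist3_ge0 _ _ _)).
have mass : ballmass lam R2 - ballmass lam R1 != 0.
  rewrite /ballmass /sinmtcos /R1 /R2 ![lam * (_ / lam)]mulrC !divfK// s1 s2 c1 c2 -mulrBr.
  rewrite mulf_neq0//.
    rewrite !mulf_neq0 ?pnatr_eq0 ?invr_eq0 ?expf_neq0//.
    by rewrite gt_eqF// polarconst_gt0.
  have : 0 < t1 by rewrite (lt_trans _ t1r)// mulr_gt0.
  by move=> t10; rewrite gt_eqF// /t2; lra.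
set L := (X in X = _ -> _); set L' := (X in _ = X -> _).
have x00 : dist3 x0 x0 = 0 by apply/eqP; rewrite dist3_eq0.
(* Off [D] the inner integral is [c] times the kernel centred at [x0]. The shell formula at [x0]
   itself then yields the value of [sinc] at 0, which is [lam]. *)
have -> : L = c * ((ballmass lam R2 - ballmass lam R1) * lam).
  have [i2 _] := ball_sin R lam R2 x0 x0 l0 (ltac:(by rewrite x00)).
  have := shell_sin lam R1 R2 x0 x0 l0 (ltac:(by rewrite x00)) R12.
  rewrite x00 /sinc eqxx => <-; rewrite -RintegralZl//; last first.
    by apply: (@integrableS _ _ _ _ (ball3 x0 R2 : set T3)) => //; exact: measurable_ball3.
  by apply: eq_Rintegral => x; rewrite inE => /SD /H.
have -> : L' = (ballmass lam R2 - ballmass lam R1) *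
    \int[lebT3 R]_(y in D) sinc R lam (dist3 x0 y).
  rewrite -RintegralZl//; last first.
    apply: (bounded_integrable R D _ lam mD Df (measurable_sinc lam x0)).
    by move=> y; apply: norm_sinc_le => //; exact: dist3_ge0.
  apply: eq_Rintegral => y; rewrite inE => /DB yB.
  have yR : dist3 x0 y < R1 by rewrite dist3C; exact: lt_trans R01.
  rewrite -(shell_sin lam R1 R2 y x0 l0 yR R12).
  by apply: eq_Rintegral => x _; rewrite /= dist3C.
by rewrite mulrCA => /(mulfI mass).
Qed.

End MeanValue.

(** * Monotonicity of the kernel and comparison of the two sets *)

Section Rigidity.
Context (R : realType).
Local Notation mR := (measurableTypeR R).
Local Notation T3 := (mR * mR * mR)%type.

(** For [u > 0] the derivative is [- sinmtcos (lam u) / u^2], negative below [r0]. The end point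
    [a = 0] is handled apart, by the mean value theorem for [sin]. *)
Lemma sinc_decreasing (lam r0 a b : R) : 0 < lam -> first_pos_zero_J32 (lam * r0) ->
  0 <= a -> a < b -> b <= r0 -> sinc R lam b < sinc R lam a.
Proof.
move=> l0 fz a0 ab br.
have b0 : 0 < b by exact: le_lt_trans ab.
have pos (u : R) : 0 < u < b -> 0 < sinmtcos R (lam * u).
  move=> /andP[u0 ub]; apply: (sinmtcos_gt0 R (lam * r0)) => //.
  by rewrite mulr_gt0//= ltr_pM2l// (lt_le_trans ub).
rewrite /sinc (gt_eqF b0); case: ifPn => [/eqP az|an].
  have v0 : 0 < lam * b by rewrite mulr_gt0.
  rewrite ltr_pdivrMr//.
  have [] := @MVT R sin cos 0 (lam * b) v0.
    by apply: continuous_subspaceT => x; exact: continuous_sin.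
  move=> c; rewrite in_itv/= sin0 !subr0 => /andP[c0 cb] ->.
  (* If [cos c = 1] then [sin c = 0] and [sinmtcos c = - c < 0], against the positivity before the
     first zero. *)
  rewrite gtr_pMl// lt_neqAle cos_le1 andbT; apply/eqP => cc.
  have := pos (c / lam); rewrite divr_gt0// ltr_pdivrMr// mulrC cb => /(_ isT).
  rewrite mulrC divfK ?gt_eqF// /sinmtcos cc mulr1.
  have := cos2Dsin2 c; rewrite cc expr1n => h.
  have s0 : sin c ^+ 2 = 0 by lra.
  by move/eqP: s0; rewrite sqrf_eq0 => /eqP ->; lra.
have ap : 0 < a by rewrite lt_neqAle eq_sym an.
pose f (u : R) := sin (lam * u) * u^-1.
pose f' (u : R) := - (sinmtcos R (lam * u) / u ^+ 2).
have df (u : R) : 0 < u -> is_derive u 1 f (f' u).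
  move=> u0; have un : u != 0 by rewrite gt_eqF.
  apply: deriv_eq (deriv_mul _ _ _ _ _ _ (deriv_sin _ lam u)
    (deriv_inv _ (fun u : R => u) _ _ un (deriv_id _ u))) _ _ => //.
  by rewrite /f' /sinmtcos; field.
have [] := @MVT R f f' a b ab.
- by move=> u; rewrite in_itv/= => /andP[au _]; apply: df; exact: lt_trans au.
- apply: within_itv_continuous => u /andP[au _].
  by apply: is_derive_continuous (df u _); exact: lt_le_trans au.
move=> u; rewrite in_itv/= => /andP[au ub] E.
have u0 : 0 < u by exact: lt_trans au.
have : f b - f a < 0.
  rewrite E /f' mulNr oppr_lt0 mulr_gt0 ?subr_gt0// divr_gt0 ?exprn_gt0//.
  by apply: pos; rewrite u0.
by rewrite subr_lt0.
Qed.

(** This is [ball_sin] at the centre; [sinc] and the quotient differ only at the null set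
    [[set x0]]. *)
Lemma Rintegral_sinc_ball (lam r : R) (x0 : R3 R) : 0 < lam -> 0 < r ->
  \int[lebT3 R]_(y in (ball3 x0 r : set T3)) sinc R lam (dist3 x0 y) =
  ballmass R lam r * lam.
Proof.
move=> l0 r0; have x00 : dist3 x0 x0 = 0 by apply/eqP; rewrite dist3_eq0.
have [i E] := ball_sin R lam r x0 x0 l0 (ltac:(by rewrite x00)).
have s00 : sinc R lam 0 = lam by rewrite /sinc eqxx.
move: E; rewrite x00 s00 -/(sinmtcos R (lam * r)) -/(ballmass R lam r) => <-.
have mB := measurable_ball3 R x0 r; have m1 := measurable_set1_T3 R x0.
rewrite /Rintegral; congr fine.
rewrite [LHS](negligible_integral m1 mB _ (lebT3_set1 R x0)); last first.
  apply: (bounded_integrable R _ _ lam mB (ball3_fin R x0 r r0) (measurable_sinc R lam x0)).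
  by move=> y; apply: norm_sinc_le => //; exact: dist3_ge0.
rewrite [RHS](negligible_integral m1 mB i (lebT3_set1 R x0)).
apply: eq_integral => y; rewrite inE => -[_ yx] /=; rewrite /sinc dist3C dist3_eq0.
by case: eqVneq => // yx'; case: yx.
Qed.

(** From [s cos s < sin s] follows [s - sin s < s (1 - cos s)], and this is at most
    [t (1 - cos s)]. *)
Lemma cos_defect_lt0 (j t s : R) : first_pos_zero_J32 j -> 0 < s -> s < t -> t <= j ->
  t * (cos s - 1) + s - sin s < 0.
Proof.
move=> fz s0 st tj; have := sinmtcos_gt0 R j s fz.
rewrite s0 (lt_le_trans st tj) => /(_ isT); rewrite /sinmtcos => h.
by have := cos_le1 s; nra.
Qed.

Lemma ballmassE (lam r : R) (x0 : R3 R) : 0 < lam -> 0 < r ->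
  fine (lebT3 R (ball3 x0 r)) * a3m (lam * r) = ballmass R lam r.
Proof.
move=> l0 r0; rewrite lebT3_ball3//= a3mE ?mulr_gt0// /ballmass exprMn.
by field; rewrite !gt_eqF.
Qed.

Lemma open_exterior (D : set (R3 R)) (x0 : R3 R) (r : R) : open D ->
  open (D `&` [set y | r < dist3 y x0]).
Proof.
move=> oD; apply: openI => //.
have c : continuous (fun y : R3 R => dist3 y x0).
  move=> y; apply: (@continuous_comp _ _ _ (sqdist R x0 : R3 R -> R) Num.sqrt).
    have cX (f : R3 R -> R) (a : R) : {for y, continuous f} ->
        {for y, continuous (fun z => (f z - a) ^+ 2)}.
      move=> cf; have cfa : {for y, continuous (fun z => f z - a)}.
        by apply: continuousB => //; exact: cvg_cst.
      exact: (continuousM cfa cfa).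
    apply: continuousD; [apply: continuousD|]; apply: cX.
    - by apply: (@continuous_comp _ _ _ fst fst); exact: cvg_fst.
    - by apply: (@continuous_comp _ _ _ fst snd); [exact: cvg_fst|exact: cvg_snd].
    - exact: cvg_snd.
  exact: sqrt_continuous.
have -> : [set y | r < dist3 y x0] = (fun y => dist3 y x0) @^-1` [set u | r < u] by [].
by apply: open_comp => [y _|]; [exact: c|exact: open_gt].
Qed.

(** Excludes points of [D] on the sphere of radius [r]: an open set that contains one also contains
    points strictly outside the ball. *)
Lemma outward (D : set (R3 R)) (x0 y : R3 R) : open D -> D y -> y != x0 ->
  exists2 z, D z & dist3 y x0 < dist3 z x0.
Proof.
move=> oD Dy yx; have [s s0 sD] := open_ball3 R D y oD Dy.
have d0 : 0 < dist3 y x0 by rewrite lt_neqAle eq_sym dist3_eq0 yx dist3_ge0.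
pose k : R := s / 2 / dist3 y x0; have k0 : 0 < k by rewrite !divr_gt0.
pose z : R3 R := (y.1.1 + k * (y.1.1 - x0.1.1), y.1.2 + k * (y.1.2 - x0.1.2),
  y.2 + k * (y.2 - x0.2)).
have zy : dist3 z y = k * dist3 y x0.
  rewrite !dist3E -[k in RHS](gtr0_norm k0) -sqrtr_sqr -sqrtrM ?sqr_ge0//.
  by congr Num.sqrt; rewrite /sqdist/=; ring.
have zx : dist3 z x0 = (1 + k) * dist3 y x0.
  have k1 : 0 < 1 + k by rewrite addr_gt0.
  rewrite !dist3E -[1 + k](gtr0_norm k1) -sqrtr_sqr -sqrtrM ?sqr_ge0//.
  by congr Num.sqrt; rewrite /sqdist/=; ring.
exists z.
  apply: sD; rewrite /ball3/= zy /k divfK ?gt_eqF//.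
  by rewrite ltr_pdivrMr// ltr_pMr// ltr1n.
by rewrite zx ltr_pMl// ltrDl.
Qed.

(** A bathtub argument: a decreasing function of the distance has the same integral over [D] and
    over the ball of the same volume, so the part of the ball missed by [D] and the part of [D]
    outside must both be null. *)
Lemma swap_null (lam r r0 : R) (D : set T3) (x0 : R3 R) :
  0 < lam -> first_pos_zero_J32 (lam * r0) -> 0 < r -> r <= r0 ->
  measurable D -> D `<=` ball3 x0 r0 -> lebT3 R (ball3 x0 r) = lebT3 R D ->
  \int[lebT3 R]_(y in D) sinc R lam (dist3 x0 y) = ballmass R lam r * lam ->
  lebT3 R (ball3 x0 r `\` D) = 0%E /\ lebT3 R (D `&` [set y | r < dist3 y x0]) = 0%E.
Proof.
move=> l0 fz r0' rr0 mD DB vol ID.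
have mB := measurable_ball3 R x0 r.
(* Subtracting the value on the sphere preserves the equality of the integrals, as the volumes
   agree, and makes [f] positive in the ball and negative beyond the sphere. *)
pose f (y : T3) := sinc R lam (dist3 x0 y) - sinc R lam r.
have mf : measurable_fun setT f by apply: measurable_funB => //; exact: measurable_sinc.
have ms := measurable_sinc R lam x0.
have sb (y : T3) : `|sinc R lam (dist3 x0 y)| <= lam.
  by apply: norm_sinc_le => //; exact: dist3_ge0.
have Bf := ball3_fin R x0 r r0'.
have Df : (lebT3 R D < +oo)%E by rewrite -vol.
have fb y : `|f y| <= lam + `|sinc R lam r|.
  by apply: le_trans (ler_normB _ _) _; rewrite lerD2r.
have int A : measurable A -> (lebT3 R A < +oo)%E -> (lebT3 R).-integrable A (EFin \o f).
  by move=> mA Af; exact: (bounded_integrable R A f _ mA Af mf fb).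
have intE A : measurable A -> (lebT3 R A < +oo)%E ->
    \int[lebT3 R]_(y in A) f y = \int[lebT3 R]_(y in A) sinc R lam (dist3 x0 y)
      - sinc R lam r * fine (lebT3 R A).
  move=> mA Af; rewrite RintegralB//.
  - by congr (_ - _); rewrite (@Rintegral_cst _ _ _ (lebT3 R) A mA (sinc R lam r)).
  - exact: (bounded_integrable R A _ lam mA Af ms sb).
  - apply: (bounded_integrable R A (fun=> sinc R lam r) `|sinc R lam r| mA Af) => //.
have eqI : \int[lebT3 R]_(y in D) f y = \int[lebT3 R]_(y in (ball3 x0 r : set T3)) f y.
  by rewrite (intE D mD Df) (intE _ mB Bf) ID (Rintegral_sinc_ball lam r x0 l0 r0') vol.
have split A B : measurable A -> measurable B -> (lebT3 R A < +oo)%E ->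
    \int[lebT3 R]_(y in A `\` B) f y =
    \int[lebT3 R]_(y in A) f y - \int[lebT3 R]_(y in A `&` B) f y.
  move=> mA mB' Af; have -> : A `\` B = A `\` (A `&` B).
    by apply/seteqP; split=> y [Ay nB]; split=> //; [case|move=> By; exact: nB].
  rewrite -Rintegral_setD//.
  - exact: measurableI.
  - exact: int.
have E : \int[lebT3 R]_(y in D `\` ball3 x0 r) f y =
    \int[lebT3 R]_(y in (ball3 x0 r : set T3) `\` D) f y.
  by rewrite !split// eqI setIC.
have mBD : measurable ((ball3 x0 r : set T3) `\` D) by exact: measurableD.
have mDB : measurable (D `\` (ball3 x0 r : set T3)) by exact: measurableD.
have BDf : (lebT3 R ((ball3 x0 r : set T3) `\` D) < +oo)%E.
  by apply: le_lt_trans Bf; apply: le_measure; rewrite ?inE//; exact: subDsetl.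
have DBf : (lebT3 R (D `\` (ball3 x0 r : set T3)) < +oo)%E.
  by apply: le_lt_trans Df; apply: le_measure; rewrite ?inE//; exact: subDsetl.
have fpos y : (ball3 x0 r : set T3) y -> 0 < f y.
  rewrite /ball3/= => yr; rewrite /f subr_gt0 dist3C.
  exact: (sinc_decreasing lam r0 _ _ l0 fz (dist3_ge0 _ _ _) yr rr0).
have fneg y : D y -> r < dist3 y x0 -> f y < 0.
  move=> /DB; rewrite /ball3/= => yr0 yr; rewrite /f subr_lt0 dist3C.
  exact: (sinc_decreasing lam r0 _ _ l0 fz (ltW r0') yr (ltW yr0)).
have fnpos y : (D `\` ball3 x0 r) y -> f y <= 0.
  (* On the sphere itself [f] vanishes, so nothing follows there; hence the strict inequality in the
     second conclusion. *)
  move=> [Dy]; rewrite /ball3/= => /negP; rewrite -leNgt le_eqVlt => /predU1P[ry|ry].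
    by rewrite /f dist3C -ry subrr.
  exact/ltW/fneg.
have p0 : 0 <= \int[lebT3 R]_(y in (ball3 x0 r : set T3) `\` D) f y.
  by apply: Rintegral_ge0 => y [/fpos/ltW].
have n0 : 0 <= - \int[lebT3 R]_(y in D `\` (ball3 x0 r : set T3)) f y.
  rewrite -mulN1r -RintegralZl//; last exact: int.
  by apply: Rintegral_ge0 => y /fnpos; rewrite mulN1r oppr_ge0.
have z1 : \int[lebT3 R]_(y in (ball3 x0 r : set T3) `\` D) f y = 0.
  by apply/eqP; rewrite eq_le p0 andbT -E -oppr_ge0.
have z2 : \int[lebT3 R]_(y in D `\` (ball3 x0 r : set T3)) (-1 * f y) = 0.
  by rewrite RintegralZl ?E ?z1 ?mulr0//; exact: int.
split.
  have := pos_integral_null R _ f mBD mf (fun y h => ltW (fpos y h.1)) (int _ mBD BDf) z1.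
  rewrite setIidl// => y [yB _] /=.
  by rewrite gt_eqF// fpos.
have mg : measurable_fun setT (fun y => -1 * f y) by exact: measurable_funM.
have ig : (lebT3 R).-integrable (D `\` (ball3 x0 r : set T3)) (EFin \o (fun y => -1 * f y)).
  apply: (bounded_integrable R _ _ _ mDB DBf mg) => y.
  by rewrite mulN1r normrN; exact: fb.
have g0 y : (D `\` (ball3 x0 r : set T3)) y -> 0 <= -1 * f y.
  by move=> /fnpos; rewrite mulN1r oppr_ge0.
have := pos_integral_null R _ _ mDB mg g0 ig z2.
set N := _ `&` _ => N0; apply/eqP; rewrite eq_le measure_ge0 andbT -N0.
have mext : measurable (D `&` [set y | r < dist3 y x0] : set T3).
  apply: measurableI => //.
  have -> : [set y : T3 | r < dist3 y x0] = (fun y : T3 => dist3 y x0) @^-1` [set` `]r, +oo[].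
    by apply/seteqP; split=> y; rewrite /= in_itv/= andbT.
  by rewrite -[X in measurable X]setTI; apply: (measurable_dist3 R x0).
apply: le_measure; rewrite ?inE//.
  apply: measurableI => //.
  have -> : [set y | -1 * f y != 0] = (fun y => -1 * f y) @^-1` (~` [set 0]).
    by apply/seteqP; split=> y /=; move/eqP.
  by rewrite -[X in measurable X]setTI; apply: mg => //; exact: measurableC.
move=> y [Dy yr]; split.
  by split=> //; rewrite /ball3/=; apply/negP; rewrite -leNgt ltW.
by rewrite /= mulN1r oppr_eq0 lt_eqF// fneg.
Qed.

End Rigidity.

(** * Real and imaginary parts of the identity, and the conclusion *)

Section Identities.
Context (R : realType).
Local Notation mR := (measurableTypeR R).
Local Notation T3 := (mR * mR * mR)%type.
Local Open Scope complex_scope.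

Lemma Eplus_identity (lam a : R) (D : set T3) (x x0 : R3 R) : fine (lebT3 R D) != 0 ->
  a%:C * Eplus lam x x0 = (fine (leb3 D))^-1%:C * cintegral3 D (fun y => Eplus lam y x) ->
  \int[lebT3 R]_(y in D) (cos (lam * dist3 y x) / dist3 y x) =
    fine (lebT3 R D) * a * (cos (lam * dist3 x x0) / dist3 x x0) /\
  \int[lebT3 R]_(y in D) (sin (lam * dist3 y x) / dist3 y x) =
    fine (lebT3 R D) * a * (sin (lam * dist3 x x0) / dist3 x x0).
Proof.
move=> vn.
have -> : cintegral3 D (fun y => Eplus lam y x) =
    (\int[lebT3 R]_(y in D) (cos (lam * dist3 y x) / dist3 y x)) +i*
    (\int[lebT3 R]_(y in D) (sin (lam * dist3 y x) / dist3 y x)) by [].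
rewrite leb3E; move: (Rintegral _ _ _) (Rintegral _ _ _) => Ic Is.
have sc (u v w : R) : u%:C * (v +i* w) = (u * v) +i* (u * w).
  by apply/eqP; rewrite eq_complex/= !mul0r subr0 addr0 !eqxx.
rewrite /Eplus !sc => -[Ec Es].
by rewrite -!mulrA Ec Es !mulrA mulfV// !mul1r.
Qed.

End Identities.

Local Open Scope complex_scope.

Theorem theorem4 (R : realType) (lam r r0 : R) (D : set (R3 R)) (x0 : R3 R) :
  0 < lam ->
  open D -> connected D -> D !=set0 -> bounded3 D ->
  connected (~` D) ->
  0 < r -> leb3 (ball3 x0 r) = leb3 D ->
  0 < r0 -> first_pos_zero_J32 (lam * r0) ->
  D x0 -> D `<=` ball3 x0 r0 ->
  (forall x, ~ D x ->
     ((a3m (lam * r))%:C * Eplus lam x x0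
        = (fine (leb3 D))^-1%:C * cintegral3 D (fun y => Eplus lam y x))
     /\
     ((a3m (lam * r))%:C * Eminus lam x x0
        = (fine (leb3 D))^-1%:C * cintegral3 D (fun y => Eminus lam y x))) ->
  D = ball3 x0 r.
Proof.
move=> l0 oD _ _ _ _ r0' vol r00 fz Dx0 DB H.
have mD := measurable_open3 R D oD.
have {}vol : lebT3 R (ball3 x0 r) = lebT3 R D by exact: vol.
have Bfin := ball3_fin R x0 r r0'.
have c0 := polarconst_gt0 R.
(* The ball of radius [r] has the volume of [D], a subset of the ball of radius [r0]. *)
have rr0 : r <= r0.
  have : (lebT3 R (ball3 x0 r) <= lebT3 R (ball3 x0 r0))%E.
    rewrite vol; apply: le_measure; rewrite ?inE//.
    exact: measurable_ball3.
  rewrite !lebT3_ball3// lee_fin ler_pM2l; last by rewrite mulr_gt0.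
  by rewrite ler_pXn2r// nnegrE ltW.
have vpos : 0 < fine (lebT3 R D).
  by rewrite -vol lebT3_ball3//= !mulr_gt0 ?exprn_gt0.
have mass : fine (lebT3 R D) * a3m (lam * r) = ballmass R lam r.
  by rewrite -vol; exact: ballmassE.
have vn : fine (lebT3 R D) != 0 by rewrite gt_eqF.
have Id x (nDx : ~ D x) := Eplus_identity R lam _ D x x0 vn (H x nDx).1.
have IS : \int[lebT3 R]_(y in D) sinc R lam (dist3 x0 y) = ballmass R lam r * lam.
  apply: (mean_value_center R lam r0 _ D x0 l0 r00 mD DB) => x nDx.
  by have [_ ->] := Id x nDx; rewrite mass.
have [BD0 ext0] := swap_null R lam r r0 D x0 l0 fz r0' rr0 mD DB vol IS.
have E0 := null_open3 R _ (open_exterior R D x0 r oD) ext0.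
have sub : D `<=` ball3 x0 r.
  move=> y Dy; rewrite /ball3/= ltNge; apply/negP => ry.
  have yx : y != x0.
    rewrite -dist3_eq0 gt_eqF//; exact: lt_le_trans ry.
  have [z Dz yz] := outward R D x0 y oD Dy yx.
  have : (D `&` [set y | r < dist3 y x0]) z by split=> //; exact: le_lt_trans yz.
  by rewrite E0.
apply/seteqP; split=> // x xB; apply: contrapT => nDx.
have x0x : x0 != x by apply/eqP => e; apply: nDx; rewrite -e.
have dr : dist3 x0 x < r by rewrite dist3C.
have [ic Ec] := ball_cos R lam r x x0 l0 dr x0x.
move: Ec.
have mB := measurable_ball3 R x0 r.
have mBD : measurable (ball3 x0 r `\` D : set (measurableTypeR R * measurableTypeR R * measurableTypeR R)).
  exact: measurableD.
(* [D] lies in the ball and the remainder is null, so the cosine integral over the ball may be taken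
   over [D]. *)
have -> : \int[lebT3 R]_(y in ball3 x0 r) (cos (lam * dist3 y x) / dist3 y x) =
    \int[lebT3 R]_(y in D) (cos (lam * dist3 y x) / dist3 y x).
  rewrite /Rintegral (negligible_integral mBD mB ic BD0).
  by rewrite setDD setIidr.
have [-> _] := Id x nDx.
(* By the identity at [x], the left-hand side of the defect formula is now 0, while its right-hand
   side is a positive factor times a negative number. *)
rewrite mass -/(sinmtcos R (lam * r)) -/(ballmass R lam r) (dist3C _ x x0) subrr /=.
set s := lam * r - lam * dist3 x0 x => E.
have d0 : 0 < dist3 x0 x by rewrite lt_neqAle eq_sym dist3_eq0 x0x dist3_ge0.
have s0 : 0 < s by rewrite subr_gt0 ltr_pM2l.
have st : s < lam * r by rewrite ltrBlDr ltrDl mulr_gt0.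
have tj : lam * r <= lam * r0 by rewrite ler_pM2l.
have := cos_defect_lt0 R _ _ _ fz s0 st tj; move: E.
set K := _ / dist3 x0 x => E neg.
have K0 : 0 < K by rewrite !divr_gt0 ?mulr_gt0 ?exprn_gt0.
by have := pmulr_rlt0 (lam * r * (cos s - 1) + s - sin s) K0; rewrite -E ltxx neg.
Qed.
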